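(* Consider a two-color balanced affine tenable urn model with sample size $m\ge 1$, under either sampling model $\mathcal{M}$ (without replacement) or $\mathcal{R}$ (with replacement), which is either a large-index urn ($a_m\neq 0$ and $\frac12<\Lambda<1$) or a triangular urn ($a_m=0$, $a_{m-1}>0$, $\sigma\ge m a_{m-1}$). Let $\tilde W_n=W_n-\frac{a_m}{1-\Lambda}n$ (so $\tilde W_n=W_n$ when $a_m=0$), and put $C=\frac{\Lambda\sigma}{m}$. Then for every integer $s\ge 1$ the limit $$E_s=\lim_{n\to\infty}\mathbb{E}\Big[\frac{\tilde W_n^s}{n^{s\Lambda}}\Big]$$ exists. For $s=1$, $$E_1=\Big(W_0-\frac{a_m T_0/\sigma}{1-\Lambda}\Big)\frac{\Gamma(\frac{T_0}{\sigma})}{\Gamma(\frac{T_0}{\sigma}+\Lambda)}.$$ For $s\ge 1$, under model $\mathcal{M}$, $$E_s=\bigg(\prod_{\ell=1}^{s^*}\frac{\Gamma(\frac{T_0+1-\ell}{\sigma})}{\Gamma(\lambda_{\ell,s})}\bigg)\bigg(W_0^s+\sum_{\ell=1}^{\infty}\frac{\sum_{i=0}^{s-1}f_{\ell,s,i}\,\mathbb{E}[\tilde W_{\ell-1}^i]}{\prod_{j=1}^{\ell}f_{j,s,s}}\bigg),$$ where $s^*=\min\{s,m\}$ and $\lambda_{1,s},\dots,\lambda_{s^*,s}$ are the negated (complex) roots, with multiplicity, of the monic polynomial $$P_s(x)=\frac{s^*!}{\sigma^{s^*}}\sum_{\ell=0}^{s^*}\frac{\binom{s}{\ell}}{\binom{s^*}{\ell}}C^\ell\binom{m}{\ell}\binom{x\sigma+T_0-\ell}{s^*-\ell},\qquad\text{i.e.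 } P_s(x)=\prod_{\ell=1}^{s^*}(x+\lambda_{\ell,s}).$$ Under model $\mathcal{R}$, $$E_s=\bigg(\frac{\Gamma(\frac{T_0}{\sigma})^s}{\prod_{\ell=1}^{s}\Gamma(\mu_{\ell,s})}\bigg)\bigg(W_0^s+\sum_{\ell=1}^{\infty}\frac{\sum_{i=0}^{s-1}f_{\ell,s,i}\,\mathbb{E}[\tilde W_{\ell-1}^i]}{\prod_{j=1}^{\ell}f_{j,s,s}}\bigg),$$ where $\mu_{1,s},\dots,\mu_{s,s}$ are the negated (complex) roots, with multiplicity, of the monic polynomial $$Q_s(x)=\frac{1}{\sigma^s}\sum_{\ell=0}^{s}\binom{s}{\ell}C^\ell\binom{m}{\ell}\ell!\,(x\sigma+T_0)^{s-\ell},\qquad\text{i.e. } Q_s(x)=\prod_{\ell=1}^{s}(x+\mu_{\ell,s}).$$ The coefficients $f_{n,s,r}$ are the explicit numbers defined in the context.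
   Context: Urn model. Fix integers $m\ge1$ and $\sigma\ge1$. An urn contains white and black balls; $W_n$ and $B_n$ denote their numbers after $n$ draws ($W_0,B_0$ nonrandom), and $T_n=W_n+B_n$. At each step a sample of $m$ balls is drawn, its colors are observed, and the sample is returned to the urn; if the sample has $k$ white and $m-k$ black balls, then $a_{m-k}$ white and $b_{m-k}$ black balls are added (negative numbers mean removal), $0\le k\le m$, where $a_k,b_k$ are integers. Standing assumptions: balanced, $a_k+b_k=\sigma$ for all $0\le k\le m$, so $T_n=T_0+\sigma n$; affine, $a_k=(m-k)(a_{m-1}-a_m)+a_m$ for $0\le k\le m$; tenable, i.e. the process can be continued forever (in particular $W_n,B_n\ge0$ always; for model $\mathcal M$ one has $a_k\ge-(m-k)$ for $0\le k\le m$; for model $\mathcal R$ one has $a_k\ge -1$ for $0\le k\le m-1$ and $a_m\ge0$); and $T_0\ge m$. Sampling. Given the first $n-1$ draws, the probability that the $n$th sample has exactly $k$ white balls is $\binom{W_{n-1}}{k}\binom{B_{n-1}}{m-k}/\binom{T_{n-1}}{m}$ in model $\mathcal M$ (without replacement) and $\binom mk W_{n-1}^kB_{n-1}^{m-k}/T_{n-1}^m$ in model $\mathcal R$ (with replacement). Urn index: $\Lambda=\frac{m}{\sigma}(a_{m-1}-a_m)$. Convention: if $a_m=0$, then $\frac{a_m}{1-\Lambda}$ and $\frac{a_m}{\Lambda-1}$ are read as $0$, even if $\Lambda=1$. Also $0^0=1$ and $\mathbb E[\tilde W_n^0]=1$. Coefficients. Let ${s\brace k}$ be the Stirling numbers of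 the second kind, ${s\brack k}$ the unsigned Stirling numbers of the first kind, and $x^{\underline{k}}=x(x-1)\cdots(x-k+1)$. For $n\ge1$ and $0\le r\le s$, $$f_{n,s,r}=\sum_{j=s-r}^{s}\binom sj\Lambda^j\sum_{\ell=j-(s-r)}^{j}\binom{\ell}{j-(s-r)}\Big(\frac{a_m(n-1)}{1-\Lambda}\Big)^{\ell-j+s-r}\sum_{i=\ell}^{j}\binom ji\Big(\frac{\sigma}{m}\Big)^i\Big(\frac{a_m}{\Lambda-1}\Big)^{j-i}p_{n;(i,\ell)},$$ where, with $i^*=\min\{i,m\}$, $p_{n;(i,\ell)}=\sum_{h=\ell}^{i^*}(-1)^{h-\ell}{h\brack \ell}{i\brace h}\binom mh/\binom{T_{n-1}}{h}$ for model $\mathcal M$ and $p_{n;(i,\ell)}={i\brace\ell}\,m^{\underline{\ell}}/T_{n-1}^{\ell}$ for model $\mathcal R$. *)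

(* Defs.v *)
From HB Require Import structures.
From mathcomp Require Import all_boot all_order all_algebra.
From mathcomp Require Import complex.
From mathcomp Require Import all_classical all_reals all_analysis.

Set Implicit Arguments.
Unset Strict Implicit.
Unset Printing Implicit Defensive.

Import Order.TTheory GRing.Theory Num.Theory.
Import numFieldNormedType.Exports.

Local Open Scope classical_set_scope.
Local Open Scope ring_scope.
Local Open Scope complex_scope.

Section ComplexGamma.
Context {R : realType}.
Implicit Type z : R[i].

(* Euler's integral of t^(z-1) e^(-t) over ]0, +oo[, with
   t^(z-1) = t^(Re z - 1) (cos (Im z ln t) + i sin (Im z ln t));
   it converges for 0 < Re z only. *)
Definition euler_integral z : R[i] :=
  let: x +i* y := z in
  (\int[lebesgue_measure]_(t in `]0, +oo[)
     (t `^ (x - 1) * cos (y * ln t) * expR (- t)))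
  +i*
  (\int[lebesgue_measure]_(t in `]0, +oo[)
     (t `^ (x - 1) * sin (y * ln t) * expR (- t))).

(* Number of unit shifts bringing z into the half-plane 0 < Re z; it is 0 when
   z already lies there. *)
Definition gamma_shift z : nat := Num.truncn (1 - complex.Re z).

(* Continuation by Gamma(z) = Gamma(z + N) / (z (z + 1) ... (z + N - 1)).  The
   value at the poles 0, -1, -2, ... is 0, by division by zero. *)
Definition Gamma z : R[i] :=
  euler_integral (z + (gamma_shift z)%:R) /
  \prod_(k < gamma_shift z) (z + k%:R).

End ComplexGamma.

(* Unsigned. *)
Fixpoint stirling1 (s k : nat) : nat :=
  match s, k with
  | 0, 0 => 1
  | 0, _.+1 => 0
  | _.+1, 0 => 0
  | s'.+1, k'.+1 => s' * stirling1 s' k'.+1 + stirling1 s' k'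
  end%N.

Fixpoint stirling2 (s k : nat) : nat :=
  match s, k with
  | 0, 0 => 1
  | 0, _.+1 => 0
  | _.+1, 0 => 0
  | s'.+1, k'.+1 => k'.+1 * stirling2 s' k'.+1 + stirling2 s' k'
  end%N.

(* Binomial coefficient x (x - 1) ... (x - k + 1) / k! with an upper argument
   in a field or in a polynomial ring over a field. *)
Definition gbinom (A : unitRingType) (x : A) (k : nat) : A :=
  (\prod_(i < k) (x - i%:R)) / (k`!)%:R.

Inductive model := without_replacement | with_replacement.

(* add_white k and add_black k are a_k and b_k: the numbers of balls added when
   the sample has m - k white balls.  They are meaningful for k <= m only. *)
Record urn := Urn {
  sample_size : nat;
  balance : nat;
  white0 : nat;
  black0 : nat;
  add_white : nat -> int;
  add_black : nat -> int }.

Section Urn.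
Variable U : urn.
Local Notation m := (sample_size U).
Local Notation sigma := (balance U).
Local Notation a := (add_white U).
Local Notation b := (add_black U).

(* A history h lists the numbers of white balls in the successive samples. *)
Definition white_after (h : seq nat) : int :=
  (white0 U)%:Z + \sum_(k <- h) a (m - k)%N.

Definition black_after (h : seq nat) : int :=
  (black0 U)%:Z + \sum_(k <- h) b (m - k)%N.

Definition total0 : nat := (white0 U + black0 U)%N.

(* This is the number of balls after n draws if the urn is balanced. *)
Definition total (n : nat) : nat := (total0 + sigma * n)%N.

Definition balanced : Prop := forall k, (k <= m)%N -> a k + b k = sigma%:Z.

Definition affine : Prop := forall k, (k <= m)%N ->
  a k = (m - k)%N%:Z * (a m.-1 - a m) + a m.

Section OverReals.
Variable R : realType.

(* Probability that a sample from w white and b black balls has k <= m white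
   ones. *)
Definition draw_prob (md : model) (w b : int) (k : nat) : R :=
  match md with
  | without_replacement =>
      gbinom (w%:~R : R) k * gbinom (b%:~R : R) (m - k) /
      gbinom ((w + b)%:~R : R) m
  | with_replacement =>
      'C(m, k)%:R * w%:~R ^+ k * b%:~R ^+ (m - k) / (w + b)%:~R ^+ m
  end.

(* Histories that occur with positive probability. *)
Inductive possible (md : model) : seq nat -> Prop :=
| possible_nil : possible md [::]
| possible_rcons h k : possible md h -> (k <= m)%N ->
    0 < draw_prob md (white_after h) (black_after h) k ->
    possible md (rcons h k).

Definition tenable (md : model) : Prop :=
  (forall h, possible md h -> 0 <= white_after h /\ 0 <= black_after h) /\
  match md with
  | without_replacement => forall k, (k <= m)%N -> - (m - k)%N%:Z <= a k
  | with_replacement => (forall k, (k < m)%N -> -1 <= a k) /\ 0 <= a m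
  end.

Definition urn_assumptions (md : model) : Prop :=
  [/\ (0 < m)%N, (0 < sigma)%N, balanced, affine & tenable md] /\
  (m <= total0)%N.

(* K n is the number of white balls in the sample of draw n + 1. *)
Definition urn_process d (T : measurableType d) (P : probability T R)
    (md : model) (K : nat -> {RV P >-> nat}) : Prop :=
  (forall n x, (K n x <= m)%N) /\
  (forall (h : seq nat) (k : nat), (k <= m)%N ->
     P [set x | mkseq (fun i => K i x) (size h) = h /\ K (size h) x = k] =
     (P [set x | mkseq (fun i => K i x) (size h) = h] *
      (draw_prob md (white_after h) (black_after h) k)%:E)%E).

Definition Lambda : R := m%:R / sigma%:R * (a m.-1 - a m)%:~R.

Definition large_index : Prop := a m <> 0 /\ 2^-1 < Lambda < 1.

Definition triangular : Prop :=
  [/\ a m = 0, 0 < a m.-1 & m%:Z * a m.-1 <= sigma%:Z].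

Local Notation am := ((a m)%:~R : R).

(* W_n - a_m n / (1 - Lambda).  Here and below, since x / 0 = 0, the quotients
   of a_m by 1 - Lambda and Lambda - 1 are 0 when a_m = 0, also if
   Lambda = 1. *)
Definition tildeW (K : nat -> nat) (n : nat) : R :=
  (white_after (mkseq K n))%:~R - am / (1 - Lambda) * n%:R.

Definition moment d (T : measurableType d) (P : probability T R)
    (K : nat -> {RV P >-> nat}) (s n : nat) : R :=
  fine 'E_P[fun x => tildeW (fun i => K i x) n ^+ s].

(* In pcoef and fcoef, 1 <= n and the state of the urn is that before draw n. *)
Definition pcoef (md : model) (n i l : nat) : R :=
  match md with
  | without_replacement =>
      \sum_(l <= h < (minn i m).+1)
        (-1) ^+ (h - l) * (stirling1 h l)%:R * (stirling2 i h)%:R *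
        'C(m, h)%:R / 'C(total n.-1, h)%:R
  | with_replacement =>
      (stirling2 i l)%:R * (m ^_ l)%:R / (total n.-1)%:R ^+ l
  end.

Definition fcoef (md : model) (n s r : nat) : R :=
  \sum_(s - r <= j < s.+1) 'C(s, j)%:R * Lambda ^+ j *
    \sum_(j - (s - r) <= l < j.+1) 'C(l, j - (s - r))%:R *
      (am * n.-1%:R / (1 - Lambda)) ^+ (l + (s - r) - j) *
      \sum_(l <= i < j.+1) 'C(j, i)%:R * (sigma%:R / m%:R) ^+ i *
        (am / (Lambda - 1)) ^+ (j - i) * pcoef md n i l.

Definition Cconst : R := Lambda * sigma%:R / m%:R.

(* Monic of degree s' = min(s, m), resp. s; their values at n are
   s'! / sigma^s' * C(T_n, s') * f_{n+1,s,s}, resp.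
   (T_n / sigma)^s * f_{n+1,s,s}. *)
Definition rootpoly_without (s : nat) : {poly R} :=
  let s' := minn s m in
  ((s'`!)%:R / sigma%:R ^+ s') *:
  \sum_(l < s'.+1)
    ('C(s, l)%:R / 'C(s', l)%:R * Cconst ^+ l * 'C(m, l)%:R) *:
    gbinom (sigma%:R *: 'X + (total0%:R - l%:R)%:P) (s' - l).

Definition rootpoly_with (s : nat) : {poly R} :=
  (sigma%:R ^+ s)^-1 *:
  \sum_(l < s.+1)
    ('C(s, l)%:R * Cconst ^+ l * 'C(m, l)%:R * (l`!)%:R) *:
    (sigma%:R *: 'X + total0%:R%:P) ^+ (s - l).

Definition series_term d (T : measurableType d) (P : probability T R)
    (md : model) (K : nat -> {RV P >-> nat}) (s l : nat) : R :=
  (\sum_(i < s) fcoef md l s i * moment K i l.-1) /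
  \prod_(1 <= j < l.+1) fcoef md j s s.

(* lam lists the negated roots of p, with multiplicity. *)
Definition negated_roots (n : nat) (p : {poly R}) (lam : n.-tuple R[i]) : Prop :=
  map_poly (real_complex R) p = \prod_(l < n) ('X + (tnth lam l)%:P).

End OverReals.
End Urn.

(* Main.v *)
Require Import Defs.
From HB Require Import structures.
From mathcomp Require Import all_boot all_order all_algebra.
From mathcomp Require Import complex.
From mathcomp Require Import all_classical all_reals all_analysis measurable_realfun.
From mathcomp Require Import ring lra zify.

(** The increment of the centred number V_n of white balls is affine in the number k
of white balls of the sample, and the moments of k given the past are polynomials
in V_n.  Hence the moments satisfy a triangular linear recursion
  E V_(n+1)^s = sum_(r <= s) f_(n+1,s,r) E V_n^r      (momentS),
which comes from a one-draw identity (step_moment).  That identity is purely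
algebraic: powers are turned into falling factorials by Stirling numbers, and
the factorial moments of the sample are evaluated by Vandermonde's convolution
without replacement and by the binomial theorem with replacement.

Solving the recursion for E V_n^s gives, as V_0 = W_0,
  E V_n^s = (prod_(j <= n) f_(j,s,s)) (W_0^s + sum of the first n series terms),
so two asymptotic facts are needed.

First, prod_(j <= n) f_(j,s,s) is equivalent to a constant times n^(s Lambda).
As a function of j, f_(j+1,s,s) is a quotient of two monic polynomials of the
same degree: the numerator is the root polynomial, with negated roots lambda_l,
and the denominator has explicit real negated roots alpha_l.  By Gauss's limit
  (z (z+1) ... (z+n)) / (n! (n+1)^z) --> 1 / Gamma(z)   (gauss_product_cvg)
at every root, the product behaves like n^(sum lambda - sum alpha) times
prod Gamma(alpha_l) / Gamma(lambda_l), and comparing the subdominant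
coefficients gives sum lambda - sum alpha = s Lambda (rootpoly_without_monic,
rootpoly_with_monic, product_asymptotic).

Gauss's limit is proved from Euler's integral: Gamma(z+n+1) / (n! (n+1)^z) is
the mean of x^z for x = t / (n+1) with t distributed according to Gamma(n+1).
This law has mean 1 and concentrates at x = 1, and x^z - 1 is dominated by
eps + C (x - 1)^2 (1 + x^M), whose mean is computed from factorials
(gamma_average_cvg).  Integration by parts brings Gamma(z+n+1) back to Gamma(z).

Second, the series of the theorem converges.  By induction on s the lower
moments are O(n^(i Lambda)), while f_(n,s,i) is O(1), and even O(1/n) if a_m = 0
or i = s - 1 (decays_fcoef, decays_fcoef_lower).  So the l-th term of the series
is O(l^(-1-eps)), where eps = Lambda in the triangular case and eps is
2 Lambda - 1 for a large index: this is where 1/2 < Lambda is used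
(lower_terms_bound, recursion_limit).

For s = 1, subtracting a suitable constant from the first moment makes the
recursion homogeneous, which gives the closed form of E_1
(first_moment_limit). *)

Set Implicit Arguments.
Unset Strict Implicit.
Unset Printing Implicit Defensive.

Import Order.TTheory GRing.Theory Num.Theory.
Import numFieldNormedType.Exports.

Local Open Scope classical_set_scope.
Local Open Scope ring_scope.
Local Open Scope complex_scope.

(** * Integration over the positive half-line *)

Section PositiveRay.
Context {R : realType}.
Notation mu := (@lebesgue_measure R).
Notation ray := (`]0, +oo[%classic : set R).
Implicit Types (f F : R -> R) (a b : R).

(** Compact intervals increasing to the open half-line: the integrands below
may be singular at 0, so the half-line is exhausted at both ends. *)
Definition exhaust (n : nat) : set R := `[n.+1%:R^-1, n.+2%:R].

Lemma exhaust_lt n : 0 < (n.+1%:R^-1 : R) < n.+2%:R.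
Proof.
rewrite invr_gt0 ltr0n /=.
by rewrite (@le_lt_trans _ _ 1) ?ltr1n// invf_le1 ?ltr0n// ler1n.
Qed.

Lemma exhaust_homo : {homo exhaust : n m / (n <= m)%N >-> (n <= m)%O}.
Proof.
move=> n m nm; apply/subsetPset => x; rewrite /exhaust /= !in_itv/=.
move=> /andP[nx xn]; apply/andP; split.
  by apply: le_trans nx; rewrite lef_pV2 ?posrE ?ltr0n// ler_nat.
by apply: le_trans xn _; rewrite ler_nat.
Qed.

Lemma bigcup_exhaust : \bigcup_n exhaust n = ray.
Proof.
apply/seteqP; split=> x /=.
  move=> [n _]; rewrite /exhaust /= !in_itv/= andbT => /andP[+ _].
  by apply: lt_le_trans; have /andP[] := exhaust_lt n.
rewrite in_itv/= andbT => x0.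
pose n := maxn (Num.truncn x) (Num.truncn x^-1).
exists n => //; rewrite /exhaust/= in_itv/=; apply/andP; split.
  rewrite -[leRHS]invrK lef_pV2 ?posrE ?ltr0n ?invr_gt0//.
  apply: ltW; apply: lt_le_trans (truncnS_gt _) _.
  by rewrite ler_nat ltnS leq_maxr.
apply: ltW; apply: lt_le_trans (truncnS_gt _) _.
by rewrite ler_nat ltnS leqW// leq_maxl.
Qed.

Lemma measurable_exhaust n : measurable (exhaust n).
Proof. exact: measurable_itv. Qed.

Lemma exhaust_sub n : exhaust n `<=` ray.
Proof. by rewrite -bigcup_exhaust => x nx; exists n. Qed.

Lemma integral_exhaust f F n :
  (forall x : R, 0 < x -> is_derive x 1 F (f x)) ->
  (forall x : R, 0 < x -> {for x, continuous f}) ->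
  (\int[mu]_(x in exhaust n) (f x)%:E)%E =
  (F n.+2%:R - F n.+1%:R^-1)%:E.
Proof.
move=> dF cf; have /andP[n0 nn] := exhaust_lt n.
have cF x : 0 < x -> {for x, continuous F}.
  move=> x0; apply: differentiable_continuous; apply/derivable1_diffP.
  by have [] := dF _ x0.
rewrite EFinB; apply: continuous_FTC2 => //.
- apply: continuous_in_subspaceT => x; rewrite inE /= in_itv/= => /andP[nx _].
  by apply: cf; exact: lt_le_trans nx.
- split=> [x| |].
  + rewrite in_itv/= => /andP[nx _].
    by have [] := dF _ (lt_trans n0 nx).
  + by apply: cvg_at_right_filter; exact: cF.
  + by apply: cvg_at_left_filter; apply: cF; rewrite ltr0n.
- move=> x; rewrite in_itv/= => /andP[nx _].
  by rewrite derive1E; have [_ ->] := dF _ (lt_trans n0 nx).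
Qed.

Lemma measurable_ray f : (forall x : R, 0 < x -> {for x, continuous f}) ->
  measurable_fun ray f.
Proof.
move=> cf; apply: open_continuous_measurable_fun; first exact: interval_open.
by move=> x; rewrite inE/= in_itv/= andbT; exact: cf.
Qed.

(** The integrals over the exhausting intervals are increments of the bounded
primitive F, so monotone convergence bounds the integral over the half-line. *)
Lemma integrable_ray f F (M : R) :
  (forall x : R, 0 < x -> is_derive x 1 F (f x)) ->
  (forall x : R, 0 < x -> {for x, continuous f}) ->
  (forall x : R, 0 < x -> 0 <= f x) -> (forall x : R, 0 < x -> `|F x| <= M) ->
  mu.-integrable ray (EFin \o f).
Proof.
move=> dF cf f0 FM.
have mf := measurable_ray cf.
have mfE : measurable_fun ray (EFin \o f) by exact/measurable_EFinP.
apply/integrableP; split=> //.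
rewrite (_ : (\int[mu]_(x in _) _)%E = (\int[mu]_(x in ray) (f x)%:E)%E); last first.
  apply: eq_integral => x; rewrite inE/= in_itv/= andbT.
  by move=> x0; rewrite /= ger0_norm// f0.
apply: (@le_lt_trans _ _ (M + M)%:E); last exact: ltry.
rewrite -bigcup_exhaust.
have h := @ge0_nondecreasing_set_cvg_integral _ (measurableTypeR R) R exhaust (EFin \o f) mu
  exhaust_homo measurable_exhaust.
have {}h : (\int[mu]_(x in exhaust i) (EFin \o f) x)%E @[i --> \oo] -->
    (\int[mu]_(x in \bigcup_i exhaust i) (EFin \o f) x)%E.
  apply: h => [i|i x /exhaust_sub/=].
    by apply: measurable_funS mfE => //; exact: exhaust_sub.
  by rewrite in_itv/= andbT lee_fin; exact: f0.
rewrite -(cvg_lim _ h)//; apply: lime_le; first by apply/cvg_ex; eexists; exact: h.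
apply: nearW => n /=; rewrite (integral_exhaust _ dF)// lee_fin.
apply: le_trans (ler_norm _) _; apply: le_trans (ler_normB _ _) _.
by apply: lerD; apply: FM; rewrite ?invr_gt0 ltr0n.
Qed.

(** Fundamental theorem of calculus with boundary values given as limits; for a
signed integrand, dominated convergence passes to the limit in the exhaustion. *)
Lemma integral_ray f F l0 l1 :
  (forall x : R, 0 < x -> is_derive x 1 F (f x)) ->
  (forall x : R, 0 < x -> {for x, continuous f}) ->
  mu.-integrable ray (EFin \o f) ->
  F x @[x --> 0^'+] --> l0 -> F x @[x --> +oo] --> l1 ->
  \int[mu]_(x in ray) f x = l1 - l0.
Proof.
move=> dF cf fi F0 F1.
have mf := measurable_ray cf.
have mfE : measurable_fun ray (EFin \o f) by exact/measurable_EFinP.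
pose fn n x := ((f \_ (exhaust n)) x)%:E.
have mfn n : measurable_fun ray (fn n).
  apply/measurable_EFinP/measurable_funTS; apply/measurable_restrict => //.
    exact: measurable_exhaust.
  rewrite setTI; apply: measurable_funS mf => //.
  exact: exhaust_sub.
have [||_ _ h] := @dominated_convergence _ (measurableTypeR R) R mu ray (measurable_itv _) fn
  (EFin \o f) (abse \o (EFin \o f)) mfn mfE _ (integrable_abse fi) _.
- apply: aeW => x xray; apply: cvg_near_cst.
  move: xray; rewrite -bigcup_exhaust => -[N _ xN].
  near=> n; rewrite /fn patchE ifT//.
  rewrite inE; have /subsetPset : (exhaust N <= exhaust n)%O.
    by apply: exhaust_homo; near: n; exact: nbhs_infty_ge.
  exact.
- apply: aeW => x n _; rewrite /fn patchE /=.
  by case: ifP => // _; rewrite normr0 lee_fin.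
have {}h : (\int[mu]_(x in ray) fn n x)%E @[n --> \oo] -->
   (\int[mu]_(x in ray) (f x)%:E)%E by [].
have E n : (\int[mu]_(x in ray) fn n x)%E = (F n.+2%:R - F n.+1%:R^-1)%:E.
  rewrite -(integral_exhaust n dF cf).
  rewrite -[in RHS](setIidr (@exhaust_sub n)) integral_mkcondr.
  apply: eq_integral => x _; rewrite /fn !patchE.
  by case: ifP.
rewrite /Rintegral.
suff h1 : (F n.+2%:R - F n.+1%:R^-1)%:E @[n --> \oo] --> (l1 - l0)%:E.
  move: h; rewrite (funext E) => h.
  by rewrite (cvg_unique _ h h1).
apply: cvg_EFin; first exact: nearW.
apply: cvgB.
  have : (fun n => n.+2%:R : R) @ \oo --> +oo.
    apply/cvgryPge => A; near=> n; rewrite (@le_trans _ _ n%:R) ?ler_nat ?leqW//.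
    by near: n; exact: nbhs_infty_ger.
  by move/cvg_comp; apply.
move/cvg_at_rightP : F0; apply; split=> [n|]; first by rewrite invr_gt0 ltr0n.
exact: cvg_harmonic.
Unshelve. all: end_near. Qed.

End PositiveRay.

Section GammaKernel.
Context {R : realType}.
Notation mu := (@lebesgue_measure R).
Notation ray := (`]0, +oo[%classic : set R).
Implicit Types (phi psi : R -> R) (a b t : R).

(** With phi = cos or phi = sin and z = a + i b, the real or the imaginary part of
t^(z-1) exp(-t). *)
Definition gamma_kernel phi a b t : R :=
  t `^ (a - 1) * phi (b * ln t) * expR (- t).

(** Apply u <= exp(u) to u = t / (2 a) and raise to the power a. *)
Lemma powR_le_expR a t : 0 < a -> 0 < t ->
  t `^ a <= (2 * a) `^ a * expR (t / 2).
Proof.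
move=> a0 t0; have a20 : 0 < 2 * a by rewrite mulr_gt0.
have -> : t / 2 = (t / (2 * a)) * a by field; rewrite gt_eqF.
rewrite expRM -powRM ?expR_ge0//; last exact: ltW.
apply: ge0_ler_powR; rewrite ?nnegrE ?mulr_ge0 ?expR_ge0 ?ltW//.
rewrite -ltr_pdivrMl// mulrC.
by apply: lt_le_trans (expR_ge1Dx _); rewrite ltrDr.
Qed.

Lemma powR_continuous a t : 0 < t -> {for t, continuous (fun x => x `^ a)}.
Proof.
move=> t0; apply: differentiable_continuous; apply/derivable1_diffP.
by have [] := is_derive1_powR a t0.
Qed.

Lemma gamma_kernel_continuous phi a b t : continuous phi -> 0 < t ->
  {for t, continuous (gamma_kernel phi a b)}.
Proof.
move=> cphi t0; rewrite /gamma_kernel.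
apply: continuousM; first apply: continuousM.
- exact: powR_continuous.
- apply: continuous_comp; last exact: cphi.
  by apply: continuousM; [exact: cst_continuous|exact: continuous_ln].
- apply: continuous_comp; last exact: continuous_expR.
  exact: opp_continuous.
Qed.

Lemma norm_gamma_kernel phi a b t : (forall x, `|phi x| <= 1) ->
  `|gamma_kernel phi a b t| <= t `^ (a - 1) * expR (- t).
Proof.
move=> phi1; rewrite /gamma_kernel !normrM (ger0_norm (powR_ge0 _ _)) (ger0_norm (expR_ge0 _)).
by rewrite ler_pM2r ?expR_gt0// ler_piMr ?powR_ge0 ?phi1.
Qed.

(** The kernel is dominated by a multiple of t^(a-1) / (1 + t^a)^2, which has the
bounded primitive - 1 / (a (1 + t^a)): one function controls both ends of the
half-line. *)
Lemma gamma_kernel_integrable phi a b : continuous phi ->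
  (forall x, `|phi x| <= 1) -> 0 < a ->
  mu.-integrable ray (EFin \o gamma_kernel phi a b).
Proof.
move=> cphi phi1 a0.
(* 1 + t^a <= C exp(t/2), by powR_le_expR and 1 <= exp(t/2). *)
pose C := 1 + (2 * a) `^ a.
have C0 : 0 < C by rewrite ltr_pwDl// powR_ge0.
pose h t := 1 + t `^ a.
have h0 t : 0 < h t by rewrite ltr_pwDl// powR_ge0.
pose f t := C ^+ 2 * (t `^ (a - 1) * h t ^- 2).
pose F t := - (C ^+ 2 / a) * (h t)^-1.
have ch t : 0 < t -> {for t, continuous h}.
  by move=> t0; apply: continuousD; [exact: cst_continuous|exact: powR_continuous].
have fi : mu.-integrable ray (EFin \o f).
  apply: (@integrable_ray _ f F (C ^+ 2 / a)).
  - move=> t t0.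
    have dh : is_derive t 1 h (a * t `^ (a - 1)).
      have h1 := is_derive1_powR a t0.
      rewrite -[a * _]add0r; exact: is_deriveD.
    have h1 : is_derive t 1 (fun x => (h x)^-1) (- h t ^- 2 *: (a * t `^ (a - 1))).
      by apply: is_deriveV => //; rewrite gt_eqF.
    have h2 : is_derive t 1 F (- (C ^+ 2 / a) *: (- h t ^- 2 *: (a * t `^ (a - 1)))).
      exact: is_deriveZ.
    apply: is_derive_eq h2 _; rewrite /f /GRing.scale /=.
    by field; rewrite !gt_eqF.
  - move=> t t0; apply: continuousM; first exact: cst_continuous.
    apply: continuousM; first exact: powR_continuous.
    apply: continuousV; first by rewrite gt_eqF// exprn_gt0.
    apply: (@continuous_comp _ _ _ h (fun x : R => x ^+ 2)); first exact: ch.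
    exact: exprn_continuous.
  - move=> t t0; rewrite /f !mulr_ge0 ?powR_ge0 ?invr_ge0 ?exprn_ge0//; exact: ltW.
  - move=> t t0; rewrite /F normrM normrN.
    have Ca0 : 0 <= C ^+ 2 / a by rewrite divr_ge0 ?exprn_ge0// ltW.
    have hV0 : 0 <= (h t)^-1 by rewrite invr_ge0 ltW.
    rewrite (ger0_norm Ca0) (ger0_norm hV0); apply: ler_piMr => //.
    by rewrite invf_le1// lerDl powR_ge0.
apply: le_integrable fi; first exact: measurable_itv.
  apply/measurable_EFinP; apply: measurable_ray => t t0.
  exact: gamma_kernel_continuous.
move=> t /=; rewrite in_itv/= andbT => t0.
rewrite lee_fin; apply: le_trans (norm_gamma_kernel _ _ _ phi1) _.
rewrite ger0_norm; last first.
  by rewrite /f !mulr_ge0 ?powR_ge0 ?invr_ge0 ?exprn_ge0//; exact: ltW.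
rewrite /f mulrCA ler_wpM2l ?powR_ge0//.
rewrite expRN ler_pdivlMr ?exprn_gt0// mulrC ler_pdivrMr ?expR_gt0//.
have -> : expR t = expR (t / 2) ^+ 2 by rewrite expr2 -expRD -splitr.
rewrite -exprMn lerXn2r ?nnegrE//; [exact: ltW|by rewrite mulr_ge0 ?expR_ge0// ltW|].
rewrite /h /C mulrDl mul1r lerD//; last exact: powR_le_expR.
by apply: le_trans (expR_ge1Dx _); rewrite lerDl divr_ge0// ltW.
Qed.

(** The derivative of t^a phi(b ln t) exp(-t) is a combination of three kernels, and
this function vanishes at both ends.  For phi = cos and phi = sin these are the
real and the imaginary part of Gamma(z+1) = z Gamma(z). *)
Lemma gamma_kernel_by_parts phi psi a b :
  (forall x : R, is_derive x 1 phi (psi x)) -> continuous psi ->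
  (forall x, `|phi x| <= 1) -> (forall x, `|psi x| <= 1) -> 0 < a ->
  \int[mu]_(t in ray) gamma_kernel phi (a + 1) b t =
  a * (\int[mu]_(t in ray) gamma_kernel phi a b t) +
  b * (\int[mu]_(t in ray) gamma_kernel psi a b t).
Proof.
move=> dphi cpsi phi1 psi1 a0.
have cphi : continuous phi.
  move=> x; apply: differentiable_continuous; apply/derivable1_diffP.
  by have [] := dphi x.
pose F t := t `^ a * phi (b * ln t) * expR (- t).
pose f t := a * gamma_kernel phi a b t + b * gamma_kernel psi a b t
  - gamma_kernel phi (a + 1) b t.
have i1 := gamma_kernel_integrable b cphi phi1 a0.
have i2 := gamma_kernel_integrable b cpsi psi1 a0.
have a10 : 0 < a + 1 by rewrite addr_gt0.
have i3 := gamma_kernel_integrable b cphi phi1 a10.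
have mr : measurable ray by exact: measurable_itv.
have i1' : mu.-integrable ray (EFin \o (fun t => a * gamma_kernel phi a b t)).
  by under [EFin \o _]eq_fun do rewrite /= EFinM; exact: integrableZl.
have i2' : mu.-integrable ray (EFin \o (fun t => b * gamma_kernel psi a b t)).
  by under [EFin \o _]eq_fun do rewrite /= EFinM; exact: integrableZl.
have i12 : mu.-integrable ray (EFin \o (fun t => a * gamma_kernel phi a b t + b * gamma_kernel psi a b t)).
  by under [EFin \o _]eq_fun do rewrite /= EFinD; exact: integrableD.
have i : mu.-integrable ray (EFin \o f).
  by under [EFin \o _]eq_fun do rewrite /= EFinB; exact: integrableB.
have Fle t : `|F t| <= t `^ a * expR (- t).
  rewrite /F !normrM (ger0_norm (powR_ge0 _ _)) (ger0_norm (expR_ge0 _)).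
  by rewrite ler_pM2r ?expR_gt0// ler_piMr ?powR_ge0 ?phi1.
have : \int[mu]_(t in ray) f t = 0 - 0.
  apply: (@integral_ray _ f F) => //.
  - move=> t t0; rewrite /F.
    have d1 := is_derive1_powR a t0.
    have d2 : is_derive t 1 (fun x => b * ln x) (b *: t^-1).
      have := is_derive1_ln t0; exact: is_deriveZ.
    have d3 : is_derive t 1 (fun x => phi (b * ln x)) (psi (b * ln t) * (b *: t^-1)).
      exact: (is_derive1_comp (dphi _) d2).
    have d4 : is_derive t 1 (fun x : R => expR (- x)) (expR (- t) * (- 1)).
      apply: (@is_derive1_comp _ expR (fun x => - x)).
    have := is_deriveM (is_deriveM d1 d3) d4.
    move=> h; apply: is_derive_eq h _; rewrite !fctE /f /gamma_kernel /GRing.scale /=.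
    rewrite addrK (_ : t `^ a = t `^ (a - 1) * t); first by field; rewrite gt_eqF.
    by rewrite mulrC mulr_powRB1// ltW.
  - move=> t t0; rewrite /f; apply: continuousB; first apply: continuousD.
    + apply: continuousM; first exact: cst_continuous.
      exact: gamma_kernel_continuous.
    + apply: continuousM; first exact: cst_continuous.
      exact: gamma_kernel_continuous.
    + exact: gamma_kernel_continuous.
  - apply: norm_cvg0; apply: (squeeze_cvgr _ (@cvg_cst _ 0 _ _ _) (powR_cvg0 a0)).
    near=> t; rewrite normr_ge0/=; apply: le_trans (Fle _) _.
    by rewrite ler_piMr ?powR_ge0// -expR0 ler_expR oppr_le0.
  - apply: norm_cvg0.
    have half : (fun t : R => t / 2) @ +oo%R --> +oo%R.
      apply/cvgryPge => A; apply: filterS (nbhs_pinfty_ge (num_real (A * 2))) => u.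
      by rewrite ler_pdivlMr.
    have c1 : (fun t : R => expR (- (t / 2))) @ +oo%R --> (0 : R).
      exact: (cvg_comp _ _ half (@cvgr_expR R)).
    have c0 : (fun t : R => (2 * a) `^ a * expR (- (t / 2))) @ +oo%R -->
        (2 * a) `^ a * 0.
      exact: (cvgMl_tmp c1).
    rewrite mulr0 in c0.
    apply: (squeeze_cvgr _ (@cvg_cst _ 0 _ _ _) c0).
    near=> t; rewrite normr_ge0/=; apply: le_trans (Fle _) _.
    have t0 : 0 < t by near: t; exact: nbhs_pinfty_gt.
    have -> : expR (- (t / 2)) = expR (t / 2) * expR (- t).
      by rewrite -expRD; congr expR; field.
    by rewrite mulrA ler_pM2r ?expR_gt0// powR_le_expR.
rewrite RintegralB// RintegralD// !RintegralZl// subrr => /eqP.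
by rewrite subr_eq0 => /eqP.
Unshelve. all: end_near. Qed.

End GammaKernel.

(** * Averages under the Gamma distribution *)

Section GammaAverage.
Context {R : realType}.
Notation mu := (@lebesgue_measure R).
Notation ray := (`]0, +oo[%classic : set R).
Implicit Types (psi : R -> R) (p : {poly R}) (t : R) (n k : nat).

Lemma cos_norm_le1 (x : R) : `|cos x| <= 1.
Proof. by rewrite ler_norml cos_geN1 cos_le1. Qed.

Lemma sin_norm_le1 (x : R) : `|sin x| <= 1.
Proof. by rewrite ler_norml sin_geN1 sin_le1. Qed.

Lemma gamma_kernel_cos0 k t : 0 < t ->
  gamma_kernel cos (k.+1%:R) 0 t = t ^+ k * expR (- t).
Proof.
move=> t0; rewrite /gamma_kernel mul0r cos0 mulr1 -natr1 addrK.
by rewrite powR_mulrn// ltW.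
Qed.

Lemma integral_expRN : \int[mu]_(t in ray) expR (- t) = 1 :> R.
Proof.
transitivity (0 - (-1) : R); last by rewrite opprK add0r.
apply: (@integral_ray R _ (fun t => - expR (- t))).
- move=> t t0.
  have := is_deriveN (is_derive1_comp (is_derive_expR (- t))
    (is_deriveN (is_derive_id t 1))).
  by move=> h; apply: is_derive_eq h _; rewrite mulrN1 opprK.
- move=> t _; apply: continuous_comp; last exact: continuous_expR.
  exact: opp_continuous.
- have := gamma_kernel_integrable 0 (@continuous_cos R) cos_norm_le1 (@ltr01 R).
  apply: eq_integrable; first exact: measurable_itv.
  move=> t; rewrite inE/= in_itv/= andbT => t0.
  by rewrite /= (@gamma_kernel_cos0 0 t t0) expr0 mul1r.
- apply: cvg_at_right_filter.
  have : {for (0 : R), continuous (fun t : R => - expR (- t))}.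
    apply: continuousN; apply: continuous_comp; last exact: continuous_expR.
    exact: opp_continuous.
  by rewrite /continuous_at /prop_for /= oppr0 expR0.
- by rewrite -[X in _ --> X]oppr0; apply: cvgN; exact: cvgr_expR.
Qed.

Lemma integral_powexpN k : \int[mu]_(t in ray) (t ^+ k * expR (- t)) = k`!%:R.
Proof.
elim: k => [|k IH].
  rewrite fact0 -[RHS]integral_expRN; apply: eq_Rintegral => t _.
  by rewrite expr0 mul1r.
have h := @gamma_kernel_by_parts R cos (fun x => - sin x) k.+1%:R 0
   (@is_derive_cos R) _ cos_norm_le1 _ (ltr0Sn _ _).
rewrite mul0r addr0 natr1 in h.
transitivity (\int[mu]_(t in ray) gamma_kernel cos k.+2%:R 0 t).
  apply: eq_Rintegral => t; rewrite inE/= in_itv/= andbT => t0.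
  by rewrite gamma_kernel_cos0.
rewrite h.
- rewrite factS natrM -IH; congr (_ * _); apply: eq_Rintegral => t.
  by rewrite inE/= in_itv/= andbT => t0; rewrite gamma_kernel_cos0.
- by move=> x; apply: continuousN; exact: continuous_sin.
- by move=> x; rewrite normrN sin_norm_le1.
Qed.

Definition gamma_pdf n t : R := t ^+ n * expR (- t) / n`!%:R.

(** The mean of psi(t / (n+1)) for t distributed according to Gamma(n+1).  The
scaling makes this law concentrate at 1 as n grows. *)
Definition gamma_average psi n : R :=
  \int[mu]_(t in ray) (psi (t / n.+1%:R) * gamma_pdf n t).

Lemma gamma_pdf_ge0 n t : 0 <= t -> 0 <= gamma_pdf n t.
Proof. by move=> t0; rewrite /gamma_pdf !mulr_ge0 ?exprn_ge0 ?expR_ge0 ?invr_ge0. Qed.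

Definition averageable psi n :=
  mu.-integrable ray (EFin \o (fun t => psi (t / n.+1%:R) * gamma_pdf n t)).

Lemma averageableZ c psi n : averageable psi n ->
  averageable (fun x => c * psi x) n /\
  gamma_average (fun x => c * psi x) n = c * gamma_average psi n.
Proof.
move=> h; have mr : measurable (ray : set (measurableTypeR R)) by exact: measurable_itv.
split.
  have := integrableZl mr c h; apply: eq_integrable => // t _ /=.
  by rewrite -EFinM mulrA.
rewrite /gamma_average -RintegralZl//; apply: eq_Rintegral => t _.
by rewrite mulrA.
Qed.

Lemma averageableD psi1 psi2 n : averageable psi1 n -> averageable psi2 n ->
  averageable (fun x => psi1 x + psi2 x) n /\
  gamma_average (fun x => psi1 x + psi2 x) n =
  gamma_average psi1 n + gamma_average psi2 n.
Proof.
move=> h1 h2; have mr : measurable (ray : set (measurableTypeR R)) by exact: measurable_itv.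
split.
  have := integrableD mr h1 h2; apply: eq_integrable => // t _ /=.
  by rewrite -EFinD mulrDl.
rewrite /gamma_average -RintegralD//; apply: eq_Rintegral => t _.
by rewrite mulrDl.
Qed.

Lemma gamma_average_exp k n : averageable (fun x => x ^+ k) n /\
  gamma_average (fun x => x ^+ k) n =
  (n + k)`!%:R / (n`!%:R * n.+1%:R ^+ k).
Proof.
have mr : measurable (ray : set (measurableTypeR R)) by exact: measurable_itv.
have i : mu.-integrable ray (EFin \o (fun t : R => t ^+ (n + k) * expR (- t))).
  have := gamma_kernel_integrable 0 (@continuous_cos R) cos_norm_le1 (ltr0Sn R (n + k)).
  apply: eq_integrable => // t.
  by rewrite inE/= in_itv/= andbT => t0; rewrite /= gamma_kernel_cos0.
have E t : (t / n.+1%:R) ^+ k * gamma_pdf n t =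
    (n`!%:R * n.+1%:R ^+ k)^-1 * (t ^+ (n + k) * expR (- t)).
  rewrite /gamma_pdf expr_div_n exprD; field.
  by rewrite expf_neq0 ?pnatr_eq0 -?lt0n ?fact_gt0.
split.
  have := integrableZl mr (n`!%:R * n.+1%:R ^+ k)^-1 i.
  by apply: eq_integrable => // t _; rewrite /= E EFinM.
rewrite /gamma_average; under eq_Rintegral do rewrite E.
by rewrite RintegralZl// integral_powexpN mulrC.
Qed.

(** Passing from k to k+1 multiplies the k-th moment by (n+k+1) / (n+1). *)
Lemma gamma_average_exp_cvg k :
  gamma_average (fun x => x ^+ k) @ \oo --> (1 : R).
Proof.
rewrite (funext (fun n => (gamma_average_exp k n).2)).
elim: k => [|k IH].
  apply: cvg_near_cst; apply: nearW => n.
  by rewrite addn0 expr0 mulr1 divff// pnatr_eq0 -lt0n fact_gt0.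
rewrite -[X in _ --> X](mulr1 1).
have -> : (fun n => (n + k.+1)`!%:R / (n`!%:R * n.+1%:R ^+ k.+1) : R) =
  (fun n => (n + k)`!%:R / (n`!%:R * n.+1%:R ^+ k)) \*
  (fun n => 1 + k%:R * (n.+1%:R)^-1).
  apply/funext => n /=; rewrite addnS factS natrM exprS -addnS addnC natrD.
  field; rewrite ?expf_neq0 ?nat1r ?pnatr_eq0 -?lt0n ?fact_gt0//.
have c1 : (fun n => k%:R * (n.+1%:R)^-1 : R) @ \oo --> (k%:R * 0 : R).
  by apply: cvgMl_tmp; exact: cvg_harmonic.
have c2 : (fun n => 1 + k%:R * (n.+1%:R)^-1 : R) @ \oo --> (1 + k%:R * 0 : R).
  by apply: cvgD c1; exact: cvg_cst.
rewrite mulr0 addr0 in c2.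
exact: (cvgM IH c2).
Qed.

Lemma gamma_average_poly p : (forall n, averageable (horner p) n) /\
  gamma_average (horner p) @ \oo --> p.[1].
Proof.
rewrite -(coefK p) poly_def.
apply: (big_ind (fun q : {poly R} => (forall n, averageable (horner q) n) /\
  gamma_average (horner q) @ \oo --> q.[1])).
- have z : horner (0 : {poly R}) = (fun x => 0 * x ^+ 0).
    by apply/funext => x; rewrite horner0 mul0r.
  split=> [n|]; first by rewrite z; apply: (averageableZ 0 _).1; case: (gamma_average_exp 0 n).
  rewrite horner0; apply: cvg_near_cst; apply: nearW => n.
  rewrite z (averageableZ 0 _).2 ?mul0r//; by case: (gamma_average_exp 0 n).
- move=> q1 q2 [h1 c1] [h2 c2].
  have E : horner (q1 + q2) = (fun x => q1.[x] + q2.[x]).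
    by apply/funext => x; rewrite hornerD.
  rewrite E /=; split=> [n|]; first by have [] := averageableD (h1 n) (h2 n).
  rewrite (funext (fun n => (averageableD (h1 n) (h2 n)).2)).
  exact: cvgD.
- move=> i _.
  have E : horner (p`_i *: 'X^i) = (fun x => p`_i * x ^+ i).
    by apply/funext => x; rewrite hornerZ hornerXn.
  rewrite E /= expr1n; split=> [n|].
    by apply: (averageableZ _ _).1; case: (gamma_average_exp i n).
  have F n : gamma_average (fun x => p`_i * x ^+ i) n =
      p`_i * gamma_average (fun x => x ^+ i) n.
    exact: (averageableZ _ (gamma_average_exp i n).1).2.
  rewrite (funext F).
  by apply: cvgMl_tmp; exact: gamma_average_exp_cvg.
Qed.

Variables (psi : R -> R) (M : nat).
Hypothesis psi_cont : forall x : R, 0 < x -> {for x, continuous psi}.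
Hypothesis psi_bound : forall x : R, 0 < x -> `|psi x| <= 1 + x ^+ M.

Lemma averageable_bounded n : averageable psi n.
Proof.
have [+ _] := gamma_average_poly (1 + 'X^M).
move=> /(_ n); rewrite /averageable; apply: le_integrable; first exact: measurable_itv.
  apply/measurable_EFinP; apply: measurable_ray => t t0; apply: continuousM.
    apply: (@continuous_comp _ _ _ (fun t : R => t / n.+1%:R) psi); last first.
      by apply: psi_cont; rewrite divr_gt0.
    by apply: continuousM; [exact: cvg_id|exact: cst_continuous].
  apply: continuousM; last exact: cst_continuous.
  apply: continuousM; first exact: exprn_continuous.
  apply: continuous_comp; last exact: continuous_expR.
  exact: opp_continuous.
move=> t; rewrite /= in_itv/= andbT => t0; rewrite lee_fin.
rewrite !normrM ler_wpM2r// hornerD hornerXn hornerC.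
have x0 : 0 < t / n.+1%:R by rewrite divr_gt0.
apply: le_trans (psi_bound x0) _; exact: ler_norm.
Qed.

(** Concentration: near 1 use continuity, and at distance at least d from 1 use
1 <= (x-1)^2 / d^2.  Both cases are covered by the single polynomial bound
eps/2 + C (x-1)^2 (1 + x^M), whose mean tends to its value eps/2 at 1. *)
Lemma gamma_average_cvg : gamma_average psi @ \oo --> psi 1.
Proof.
have c1 := psi_cont (@ltr01 R).
apply/cvgrPdist_le => e e0.
have e20 : 0 < e / 2 by rewrite divr_gt0.
move/cvgrPdist_le : c1 => /(_ _ e20) [d /= d0 hd].
(* |psi 1 - psi x| <= 2 + 1 + x^M <= 3 (1 + x^M). *)
pose C := 3 / d ^+ 2.
pose q : {poly R} := (e / 2)%:P + C%:P * (('X - 1%:P) ^+ 2 * (1 + 'X^M)).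
have qE x : q.[x] = e / 2 + C * ((x - 1) ^+ 2 * (1 + x ^+ M)).
  by rewrite /q !hornerE.
have q1 : q.[1] = e / 2 by rewrite qE subrr expr0n /= mul0r mulr0 addr0.
have bnd x : 0 < x -> `|psi 1 - psi x| <= q.[x].
  move=> x0; rewrite qE.
  have nonneg : 0 <= 1 + x ^+ M by rewrite addr_ge0 ?exprn_ge0// ltW.
  have [xd|xd] := ltP `|1 - x| d.
    apply: le_trans (hd x xd) _; rewrite lerDl mulr_ge0//.
      by rewrite divr_ge0// exprn_ge0// ltW.
    by rewrite mulr_ge0// exprn_even_ge0.
  apply: (@le_trans _ _ (3 * (1 + x ^+ M))).
    apply: le_trans (ler_normB _ _) _.
    have h1 := psi_bound (@ltr01 R); have h2 := psi_bound x0.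
    rewrite expr1n in h1.
    have : 0 <= x ^+ M by rewrite exprn_ge0// ltW.
    lra.
  apply: (@le_trans _ _ (C * ((x - 1) ^+ 2 * (1 + x ^+ M)))); last first.
    by rewrite lerDr ltW.
  rewrite mulrA ler_wpM2r// /C mulrAC ler_pdivlMr ?exprn_gt0// ler_wpM2l//.
  by rewrite -(real_normK (num_real (x - 1))) distrC lerXn2r// ?nnegrE// ltW.
have [hq cq] := gamma_average_poly q.
rewrite q1 in cq.
have cst_av n : averageable (fun=> psi 1) n /\ gamma_average (fun=> psi 1) n = psi 1.
  have [h1 h2] := gamma_average_exp 0 n.
  have [h3 h4] := averageableZ (psi 1) h1.
  have E : (fun x : R => psi 1 * x ^+ 0) = (fun=> psi 1).
    by apply/funext => x; rewrite expr0 mulr1.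
  rewrite E in h3 h4; split=> //.
  by rewrite h4 h2 addn0 expr0 mulr1 divff ?mulr1// pnatr_eq0 -lt0n fact_gt0.
move/cvgrPdist_le : cq => /(_ _ e20) hcq.
near=> n.
have [a1 a2] := cst_av n.
have [a3 a4] := averageableZ (-1) (averageable_bounded n).
have [a5 a6] := averageableD a1 a3.
rewrite -{1}a2 (_ : _ - _ = gamma_average (fun x => psi 1 + -1 * psi x) n); last first.
  by rewrite a6 a4 mulN1r.
apply: (@le_trans _ _ (gamma_average (horner q) n)).
  rewrite /gamma_average.
  have mr : measurable (ray : set (measurableTypeR R)) by exact: measurable_itv.
  apply: le_trans (le_normr_Rintegral mr a5) _.
  apply: le_Rintegral; [exact: mr|exact: integrable_norm a5|exact: hq n|].
  move=> t; rewrite /= in_itv/= andbT => t0.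
  have x0 : 0 < t / n.+1%:R by rewrite divr_gt0.
  rewrite normrM (ger0_norm (gamma_pdf_ge0 n (ltW t0))) mulN1r.
  by rewrite ler_wpM2r ?gamma_pdf_ge0 ?bnd// ltW.
have := ler_norm (gamma_average (horner q) n - e / 2).
have : `|e / 2 - gamma_average (horner q) n| <= e / 2 by near: n; exact: hcq.
rewrite distrC; lra.
Unshelve. all: end_near. Qed.

End GammaAverage.

(** * Gauss's product for the complex Gamma function *)

Section ComplexLimits.
Context {R : realType}.
Implicit Types (u v : nat -> R) (z w : R[i]).

Lemma complexE z : z = (complex.Re z)%:C + 'i * (complex.Im z)%:C.
Proof. by case: z => a b; apply/eqP; rewrite eq_complex /=; apply/andP; split; apply/eqP; ring. Qed.

Lemma cvg_real_complex u (l : R) : u @ \oo --> l ->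
  (fun n => (u n)%:C : R[i]^o) @ \oo --> (l%:C : R[i]^o).
Proof.
move=> /cvgrPdist_lt ul; apply/cvgrPdist_lt => e e0.
have [er e0'] : e = (complex.Re e)%:C /\ 0 < complex.Re e.
  by case: e e0 => a b; rewrite ltcE /= => /andP[/eqP -> ->].
rewrite er; near=> n.
rewrite -rmorphB normc_def /= expr0n /= addr0 sqrtr_sqr ltcR.
by near: n; apply: ul.
Unshelve. all: end_near. Qed.

Lemma cvg_complex u v (l m : R) : u @ \oo --> l -> v @ \oo --> m ->
  (fun n => u n +i* v n : R[i]^o) @ \oo --> (l +i* m : R[i]^o).
Proof.
move=> ul vm.
have -> : (fun n => u n +i* v n : R[i]^o) = (fun n => (u n)%:C + 'i * (v n)%:C : R[i]^o).
  by apply/funext => n; rewrite [LHS]complexE.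
rewrite [X in _ --> X]complexE /=.
apply: cvgD; first exact: cvg_real_complex.
by apply: cvgMl_tmp; exact: cvg_real_complex.
Qed.

Lemma cvg_complex_Re (f : nat -> R[i]) z :
  (f : nat -> R[i]^o) @ \oo --> (z : R[i]^o) ->
  (fun n => complex.Re (f n)) @ \oo --> complex.Re z.
Proof.
move=> /cvgrPdist_lt fz; apply/cvgrPdist_lt => e e0.
have e0' : 0 < e%:C by rewrite ltcR.
apply: filterS (fz _ e0') => n; rewrite -ltcR; apply: le_lt_trans.
have -> : complex.Re z - complex.Re (f n) = complex.Re (z - f n).
  by case: (z) => a b; case: (f n).
exact: normc_ge_Re.
Qed.

Lemma cvg_complex_Im (f : nat -> R[i]) z :
  (f : nat -> R[i]^o) @ \oo --> (z : R[i]^o) ->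
  (fun n => complex.Im (f n)) @ \oo --> complex.Im z.
Proof.
move=> fz.
have : ((fun n => 'i * f n) : nat -> R[i]^o) @ \oo --> ('i * z : R[i]^o).
  exact: cvgMl_tmp.
move/cvg_complex_Re.
have E w : complex.Re ('i * w) = - complex.Im w.
  by case: w => a b /=; ring.
rewrite E (_ : (fun n => _) = (fun n => - complex.Im (f n))); last first.
  by apply/funext => n; rewrite E.
move=> h; rewrite -[X in _ --> X]opprK.
have -> : (fun n => complex.Im (f n)) = - (fun n => - complex.Im (f n)).
  by apply/funext => n; rewrite opprfctE opprK.
exact: cvgN.
Qed.

(** The imaginary parts are 0, hence so is their limit. *)
Lemma cvg_real_complex_inv u z :
  ((fun n => (u n)%:C) : nat -> R[i]^o) @ \oo --> (z : R[i]^o) ->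
  u @ \oo --> complex.Re z /\ z = (complex.Re z)%:C.
Proof.
move=> h; split; first exact: cvg_complex_Re h.
have h1 : (fun=> 0 : R) @ \oo --> complex.Im z := cvg_complex_Im h.
have h2 : (fun=> 0 : R) @ \oo --> (0 : R) by exact: cvg_cst.
have := cvg_unique _ h1 h2.
by case: (z) => a b /= ->.
Qed.

(** The complex power x^z = exp(z ln x) of a positive real x. *)
Definition cpow (x : R) z : R[i] :=
  (x `^ complex.Re z * cos (complex.Im z * ln x)) +i*
  (x `^ complex.Re z * sin (complex.Im z * ln x)).

Lemma cpowD x z w : 0 < x -> cpow x (z + w) = cpow x z * cpow x w.
Proof.
move=> x0; have xn0 : x != 0 by rewrite gt_eqF.
case: z => a b; case: w => c d; rewrite /cpow /=.
have -> : x `^ (a + c) = x `^ a * x `^ c by rewrite powRD// xn0 implybT.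
rewrite mulrDl cosD sinD; apply/eqP; rewrite eq_complex /=.
by apply/andP; split; apply/eqP; ring.
Qed.

Lemma cpow_real x (r : R) : cpow x r%:C = (x `^ r)%:C.
Proof. by rewrite /cpow /= mul0r cos0 sin0 mulr1 mulr0. Qed.

Lemma cpow_sum x (I : Type) (s : seq I) (F : I -> R[i]) : 0 < x ->
  cpow x (\sum_(i <- s) F i) = \prod_(i <- s) cpow x (F i).
Proof.
move=> x0; elim: s => [|i s IH].
  by rewrite !big_nil (cpow_real x 0) powRr0.
by rewrite !big_cons cpowD// IH.
Qed.

Lemma cpow_nat x n : 0 <= x -> cpow x n%:R = (x ^+ n)%:C.
Proof.
move=> x0; have -> : n%:R = (n%:R : R)%:C :> R[i] by rewrite rmorph_nat.
by rewrite cpow_real powR_mulrn.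
Qed.

Lemma cpowM x y z : 0 < x -> 0 < y -> cpow (x * y) z = cpow x z * cpow y z.
Proof.
move=> x0 y0; case: z => a b; rewrite /cpow /= powRM ?ltW// lnM// mulrDr cosD sinD.
by apply/eqP; rewrite eq_complex /=; apply/andP; split; apply/eqP; ring.
Qed.

Lemma cpow1 z : cpow 1 z = 1.
Proof. by rewrite /cpow ln1 mulr0 cos0 sin0 powR1 mulr1 mulr0. Qed.

Lemma cpow_neq0 x z : 0 < x -> cpow x z != 0.
Proof.
move=> x0; have h : cpow x z * cpow x^-1 z = 1.
  by rewrite -cpowM ?invr_gt0// divff ?cpow1// gt_eqF.
by apply: contra_eq_neq h => ->; rewrite mul0r eq_sym oner_eq0.
Qed.

Lemma cpow_re_continuous (a b x : R) : 0 < x ->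
  {for x, continuous (fun x : R => x `^ a * cos (b * ln x))}.
Proof.
move=> x0; apply: continuousM; first exact: powR_continuous.
apply: continuous_comp; last exact: continuous_cos.
by apply: continuousM; [exact: cst_continuous|exact: continuous_ln].
Qed.

Lemma cpow_im_continuous (a b x : R) : 0 < x ->
  {for x, continuous (fun x : R => x `^ a * sin (b * ln x))}.
Proof.
move=> x0; apply: continuousM; first exact: powR_continuous.
apply: continuous_comp; last exact: continuous_sin.
by apply: continuousM; [exact: cst_continuous|exact: continuous_ln].
Qed.

Lemma cvg_cpow_ratio z :
  ((fun n => cpow (n.+1%:R / n.+2%:R) z) : nat -> R[i]^o) @ \oo --> (1 : R[i]^o).
Proof.
have r1 : (fun n => n.+1%:R / n.+2%:R : R) @ \oo --> (1 : R).
  have -> : (fun n => n.+1%:R / n.+2%:R : R) = (fun n => 1 - n.+2%:R^-1).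
    apply/funext => n; have -> : n.+1%:R = n.+2%:R - 1 :> R.
      by rewrite -[n.+2%:R]natr1 addrK.
    by rewrite mulrBl divff ?pnatr_eq0// mul1r.
  rewrite -[X in _ --> X]subr0; apply: cvgB; first exact: cvg_cst.
  by have := @cvg_harmonic R; rewrite -cvg_shiftS.
rewrite -(cpow1 z) /cpow; apply: cvg_complex.
  exact: (cvg_comp _ _ r1 (@cpow_re_continuous (complex.Re z) (complex.Im z) 1 ltr01)).
exact: (cvg_comp _ _ r1 (@cpow_im_continuous (complex.Re z) (complex.Im z) 1 ltr01)).
Qed.

End ComplexLimits.

Section GaussLimit.
Context {R : realType}.
Notation mu := (@lebesgue_measure R).
Notation ray := (`]0, +oo[%classic : set R).
Implicit Types (z w : R[i]) (n : nat).

Lemma euler_integralS z : 0 < complex.Re z ->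
  euler_integral (z + 1) = z * euler_integral z.
Proof.
case: z => a b /= a0; rewrite addr0.
have cNsin : continuous (fun x : R => - sin x).
  by move=> x; apply: continuousN; exact: continuous_sin.
have Nsin1 (x : R) : `|- sin x| <= 1 by rewrite normrN sin_norm_le1.
have hc := @gamma_kernel_by_parts R cos (fun x => - sin x) a b
   (@is_derive_cos R) cNsin cos_norm_le1 Nsin1 a0.
have hs := @gamma_kernel_by_parts R sin cos a b
   (@is_derive_sin R) (@continuous_cos R) sin_norm_le1 cos_norm_le1 a0.
have i2 := gamma_kernel_integrable b (@continuous_sin R) sin_norm_le1 a0.
apply/eqP; rewrite eq_complex /=; apply/andP; split; apply/eqP; last first.
  exact: hs.
rewrite /gamma_kernel in hc; rewrite hc.
congr (_ + _); rewrite -mulrN; congr (_ * _).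
rewrite -[RHS]mulN1r -RintegralZl; [|exact: measurable_itv|exact: i2].
by apply: eq_Rintegral => t _; rewrite mulrN mulNr mulN1r.
Qed.

Lemma euler_integral_shift z n : 0 < complex.Re z ->
  euler_integral (z + n%:R) = euler_integral z * \prod_(k < n) (z + k%:R).
Proof.
move=> z0; elim: n => [|n IH]; first by rewrite addr0 big_ord0 mulr1.
rewrite -natr1 addrA euler_integralS; last first.
  rewrite (_ : complex.Re _ = complex.Re z + n%:R); first by rewrite ltr_pwDl.
  by case: (z) => a b; rewrite -(rmorph_nat (real_complex R)).
by rewrite IH big_ord_recr /= mulrC mulrA.
Qed.

(** Gauss's approximation of 1 / Gamma(z), with the power of n+1 instead of n so that
it makes sense for n = 0. *)
Definition gauss_product z n : R[i] :=
  \prod_(k < n.+1) (z + k%:R) / (n`!%:R * cpow n.+1%:R z).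

Lemma gamma_average_powR_cvg (a b : R) (phi : R -> R) : 0 < a -> continuous phi ->
  (forall x, `|phi x| <= 1) ->
  let psi x := x `^ a * phi (b * ln x) in
  (forall n, averageable psi n) /\ gamma_average psi @ \oo --> phi 0.
Proof.
move=> a0 cphi phi1 psi.
have cpsi x : 0 < x -> {for x, continuous psi}.
  move=> x0; apply: continuousM; first exact: powR_continuous.
  apply: continuous_comp; last exact: cphi.
  by apply: continuousM; [exact: cst_continuous|exact: continuous_ln].
pose M := (Num.truncn a).+1.
have bpsi x : 0 < x -> `|psi x| <= 1 + x ^+ M.
  move=> x0; rewrite /psi normrM (ger0_norm (powR_ge0 _ _)).
  apply: (@le_trans _ _ (x `^ a)); first by rewrite ler_piMr ?powR_ge0.
  have [x1|x1] := leP x 1.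
    apply: (@le_trans _ _ 1); last by rewrite lerDl exprn_ge0// ltW.
    rewrite -(powRr0 x) ger_powR ?x0//; exact: ltW.
  apply: (@le_trans _ _ (x ^+ M)); last by rewrite lerDr.
  rewrite -powR_mulrn ?(ltW x0)// ler_powR ?(ltW x1)//.
  by apply: ltW; exact: truncnS_gt.
split=> [n|]; first exact: averageable_bounded cpsi bpsi n.
have := gamma_average_cvg cpsi bpsi.
by rewrite {2}/psi powR1 ln1 mulr0 mul1r.
Qed.

(** Substitute t = (n+1) x in t^z only: the remaining factor t^n exp(-t) / n! is the
density of Gamma(n+1), and no change of variables is needed in the integral. *)
Lemma euler_integral_average z n : 0 < complex.Re z ->
  euler_integral (z + n.+1%:R) = n`!%:R * cpow n.+1%:R z *
   (gamma_average (fun x => x `^ complex.Re z * cos (complex.Im z * ln x)) n +i*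
    gamma_average (fun x => x `^ complex.Re z * sin (complex.Im z * ln x)) n).
Proof.
case: z => a b /= a0.
have n0 : 0 < n.+1%:R :> R by rewrite ltr0n.
have nf : n`!%:R != 0 :> R by rewrite pnatr_eq0 -lt0n fact_gt0.
have [ac _] := @gamma_average_powR_cvg a b cos a0 (@continuous_cos R) cos_norm_le1.
have [as_ _] := @gamma_average_powR_cvg a b sin a0 (@continuous_sin R) sin_norm_le1.
set pc := fun x : R => x `^ a * cos (b * ln x) in ac *.
set ps := fun x : R => x `^ a * sin (b * ln x) in as_ *.
pose c := n.+1%:R `^ a * cos (b * ln n.+1%:R) : R.
pose s := n.+1%:R `^ a * sin (b * ln n.+1%:R) : R.
have split_t t : 0 < t -> [/\ t `^ (a + n.+1%:R - 1) = t `^ a * t ^+ n,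
    t `^ a = n.+1%:R `^ a * (t / n.+1%:R) `^ a &
    b * ln t = b * ln n.+1%:R + b * ln (t / n.+1%:R)].
  move=> t0; have x0 : 0 < t / n.+1%:R by rewrite divr_gt0.
  have tE : t = n.+1%:R * (t / n.+1%:R) by rewrite mulrC divfK// gt_eqF.
  split.
  - rewrite -natr1 addrA addrK powRD ?powR_mulrn ?(ltW t0)//.
    by rewrite (gt_eqF t0) implybT.
  - by rewrite -powRM -?tE ?ltW.
  - by rewrite -mulrDr -lnM -?tE.
have -> : (a +i* b)%C + n.+1%:R = (a + n.+1%:R) +i* b.
  by rewrite -(rmorph_nat (real_complex R)); apply/eqP; rewrite eq_complex /= addr0 !eqxx.
have IR (f g : R -> R) u v : averageable f n -> averageable g n ->
   \int[mu]_(t in ray) (n`!%:R * ((u * f (t / n.+1%:R) + v * g (t / n.+1%:R)) * gamma_pdf n t))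
   = n`!%:R * (u * gamma_average f n + v * gamma_average g n).
  move=> hf hg.
  have [h1 h2] := averageableZ u hf; have [h3 h4] := averageableZ v hg.
  have [h5 h6] := averageableD h1 h3; have [_ h8] := averageableZ n`!%:R h5.
  rewrite -h2 -h4 -h6 -h8; apply: eq_Rintegral => t _; by rewrite mulrA.
have nC : n`!%:R = (n`!%:R)%:C :> R[i] by rewrite rmorph_nat.
rewrite nC /cpow; apply/eqP; rewrite eq_complex /=; apply/andP; split; apply/eqP.
  transitivity (\int[mu]_(t in ray) (n`!%:R * ((c * pc (t / n.+1%:R) + (- s) * ps (t / n.+1%:R)) * gamma_pdf n t))).
    apply: eq_Rintegral => t; rewrite inE/= in_itv/= andbT => t0.
    have [-> -> ->] := split_t t t0; rewrite /c /s /pc /ps /gamma_pdf cosD; field.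
    exact: nf.
  by rewrite IR// /c /s; ring.
transitivity (\int[mu]_(t in ray) (n`!%:R * ((s * pc (t / n.+1%:R) + c * ps (t / n.+1%:R)) * gamma_pdf n t))).
  apply: eq_Rintegral => t; rewrite inE/= in_itv/= andbT => t0.
  have [-> -> ->] := split_t t t0; rewrite /c /s /pc /ps /gamma_pdf sinD; field.
  exact: nf.
by rewrite IR// /c /s; ring.
Qed.

(** Both sides of Gamma(z+n+1) = Gamma(z) z (z+1) ... (z+n) are divided by
n! (n+1)^z; the left-hand side becomes an average of x^z, which tends to 1. *)
Lemma gauss_product_cvg0 z : 0 < complex.Re z ->
  ((fun n => euler_integral z * gauss_product z n) : nat -> R[i]^o) @ \oo --> (1 : R[i]^o).
Proof.
move=> z0.
have E n : euler_integral z * gauss_product z n =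
   gamma_average (fun x => x `^ complex.Re z * cos (complex.Im z * ln x)) n +i*
   gamma_average (fun x => x `^ complex.Re z * sin (complex.Im z * ln x)) n.
  have := euler_integral_shift n.+1 z0; rewrite (euler_integral_average n z0).
  rewrite /gauss_product mulrA => <-; rewrite mulrAC divff ?mul1r//.
  by rewrite mulf_neq0 ?cpow_neq0// pnatr_eq0 -lt0n fact_gt0.
rewrite (funext E); have -> : (1 : R[i]^o) = (cos 0 +i* sin 0)%C by rewrite cos0 sin0.
apply: cvg_complex.
- exact: (@gamma_average_powR_cvg _ _ cos z0 (@continuous_cos R) cos_norm_le1).2.
- exact: (@gamma_average_powR_cvg _ _ sin z0 (@continuous_sin R) sin_norm_le1).2.
Qed.

(** Otherwise the limit 1 of gauss_product_cvg0 would be 0. *)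
Lemma euler_integral_neq0 z : 0 < complex.Re z -> euler_integral z != 0.
Proof.
move=> z0; apply/eqP => e0; have := gauss_product_cvg0 z0; rewrite e0.
under eq_fun do rewrite mul0r.
move=> h; have h0 : (fun=> 0 : R[i]^o) @ \oo --> (0 : R[i]^o) by exact: cvg_cst.
have E : (1 : R[i]^o) = 0 by exact: (cvg_unique (@norm_hausdorff _ _) h h0).
by have := oner_neq0 (R[i]); rewrite [1]E eqxx.
Qed.

(** Gauss's products at z and z+1 differ by the factor z and by the ratio
((n+1)/(n+2))^z, which tends to 1; so the limit is continued to the left one unit
at a time, as Gamma is. *)
Lemma gauss_product_cvg_shift N z : 0 < complex.Re z + N%:R ->
  (gauss_product z : nat -> R[i]^o) @ \oo -->
  (\prod_(k < N) (z + k%:R) / euler_integral (z + N%:R) : R[i]^o).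
Proof.
elim: N z => [|N IH] z zN.
  rewrite addr0 in zN; rewrite big_ord0 addr0.
  have e0 := euler_integral_neq0 zN.
  have -> : (gauss_product z : nat -> R[i]^o) =
    (fun n => (euler_integral z)^-1 * (euler_integral z * gauss_product z n)).
    by apply/funext => n; rewrite mulKf.
  rewrite mul1r -[X in _ --> X]mulr1.
  exact: (cvgMl_tmp (gauss_product_cvg0 zN)).
have zN' : 0 < complex.Re (z + 1) + N%:R.
  by move: zN; case: (z) => a b /=; rewrite -natr1 -!addrA [1 + _]addrC.
rewrite -cvg_shiftS.
have -> : [sequence gauss_product z n.+1]_n =
  (fun n => z * gauss_product (z + 1) n * cpow (n.+1%:R / n.+2%:R) z).
  apply/funext => n /=; rewrite /gauss_product big_ord_recl /= addr0.
  have -> : \prod_(i < n.+1) (z + (bump 0 i)%:R) = \prod_(k < n.+1) (z + 1 + k%:R).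
    by apply: eq_bigr => i _; rewrite /bump leq0n add1n -addrA nat1r.
  have n1 : 0 < n.+1%:R :> R by rewrite ltr0n.
  have n2 : 0 < n.+2%:R :> R by rewrite ltr0n.
  rewrite cpowD// (cpow_nat 1 (ltW n1)) expr1.
  have h : cpow (n.+1%:R / n.+2%:R) z * cpow n.+2%:R z = cpow n.+1%:R z.
    by rewrite -cpowM ?divr_gt0// divfK// gt_eqF.
  rewrite -h rmorph_nat factS natrM; field.
  by rewrite !cpow_neq0 ?divr_gt0// nat1r !pnatr_eq0 -!lt0n fact_gt0.
have -> : \prod_(k < N.+1) (z + k%:R) / euler_integral (z + N.+1%:R) =
    z * (\prod_(k < N) (z + 1 + k%:R) / euler_integral (z + 1 + N%:R)) * 1.
  rewrite mulr1 mulrA big_ord_recl /= addr0 -addrA nat1r.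
  congr (_ * _ / _); apply: eq_bigr => i _.
  by rewrite /bump leq0n add1n -addrA nat1r.
exact: (cvgM (cvgMl_tmp (IH _ zN')) (cvg_cpow_ratio z)).
Qed.

Lemma gamma_shift_gt z : 0 < complex.Re z + (gamma_shift z)%:R.
Proof.
rewrite /gamma_shift; have := truncnS_gt (1 - complex.Re z).
by rewrite -natr1 ltrBlDr -addrA [X in _ < X]addrC -addrA ltrDl [1 + _]addrC.
Qed.

(** This also holds at the poles, where both the limit and the conventional inverse
of 0 are 0. *)
Lemma gauss_product_cvg z :
  (gauss_product z : nat -> R[i]^o) @ \oo --> ((Gamma z)^-1 : R[i]^o).
Proof.
by rewrite /Gamma invf_div; apply: gauss_product_cvg_shift; exact: gamma_shift_gt.
Qed.

Lemma Gamma_neq0 z : (forall k : nat, z + k%:R != 0) -> Gamma z != 0.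
Proof.
move=> h; rewrite /Gamma mulf_neq0 ?invr_eq0//.
  apply: euler_integral_neq0; have := gamma_shift_gt z.
  by case: (z) => a b /=; rewrite -(rmorph_nat (real_complex R)).
by apply/prodf_neq0 => i _.
Qed.

End GaussLimit.

(** * Stirling numbers and factorial moments *)

Section Stirling.

Lemma stirling2_small s k : (s < k)%N -> stirling2 s k = 0%N.
Proof.
elim: s k => [|s IH] [|k] //= sk.
by rewrite !IH ?muln0// ltnW.
Qed.

Lemma stirling1_small s k : (s < k)%N -> stirling1 s k = 0%N.
Proof.
elim: s k => [|s IH] [|k] //= sk.
by rewrite !IH ?muln0// ltnW.
Qed.

Lemma stirling2_nn s : stirling2 s s = 1%N.
Proof. by elim: s => //= s ->; rewrite stirling2_small ?muln0. Qed.

Lemma stirling1_nn s : stirling1 s s = 1%N.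
Proof. by elim: s => //= s ->; rewrite stirling1_small ?muln0. Qed.

Lemma mulnn_ffact n h : (n * n ^_ h = n ^_ h.+1 + h * n ^_ h)%N.
Proof.
rewrite ffactnSr; have [hn|nh] := leqP h n; last by rewrite ffact_small// !muln0 mul0n.
by rewrite [(_ * (n - h))%N]mulnC -mulnDl subnK.
Qed.

Lemma expn_stirling2 n s :
  (n ^ s = \sum_(h < s.+1) stirling2 s h * n ^_ h)%N.
Proof.
elim: s => [|s IH]; first by rewrite big_ord_recl big_ord0.
rewrite expnS IH big_distrr /= [RHS]big_ord_recl /= mul0n add0n.
under [RHS]eq_bigr do rewrite /bump leq0n add1n /= mulnDl.
rewrite big_split /=.
transitivity (\sum_(h < s.+1) stirling2 s h * (n ^_ h.+1 + h * n ^_ h))%N.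
  by apply: eq_bigr => h _; rewrite -mulnn_ffact mulnCA.
under [LHS]eq_bigr do rewrite mulnDr.
rewrite big_split /= addnC; congr (_ + _)%N.
rewrite big_ord_recl /= mul0n muln0 add0n [RHS]big_ord_recr /=.
rewrite stirling2_small// muln0 mul0n addn0.
by apply: eq_bigr => h _; rewrite /bump leq0n add1n mulnCA mulnA.
Qed.

End Stirling.

Section FallingFactorial.
Context {F : numFieldType}.
Implicit Types (x y : F).

Definition falling x (k : nat) : F := \prod_(i < k) (x - i%:R).

Lemma fallingS x k : falling x k.+1 = falling x k * (x - k%:R).
Proof. by rewrite /falling big_ord_recr. Qed.

Lemma fallingSl x k : falling x k.+1 = x * falling (x - 1) k.
Proof.
rewrite /falling big_ord_recl subr0; congr (_ * _).
by apply: eq_bigr => i _; rewrite lift0 -nat1r opprD addrA.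
Qed.

Lemma falling_nat n k : falling n%:R k = (n ^_ k)%:R.
Proof.
elim: k => [|k IH]; first by rewrite /falling big_ord0.
rewrite fallingS IH ffactnSr natrM.
have [kn|nk] := leqP k n; first by rewrite natrB.
by rewrite ffact_small// !mul0r.
Qed.

(** The range of summation is any N >= h, so that sums over h and l can be exchanged
as if they were over a square. *)
Lemma falling_stirling1 x h N : (h <= N)%N ->
  falling x h = \sum_(l < N.+1) (-1) ^+ (h - l) * (stirling1 h l)%:R * x ^+ l.
Proof.
move=> hN.
have -> : \sum_(l < N.+1) (-1) ^+ (h - l) * (stirling1 h l)%:R * x ^+ l =
   \sum_(l < h.+1) (-1) ^+ (h - l) * (stirling1 h l)%:R * x ^+ l.
  rewrite -(big_mkord xpredT (fun l => (-1) ^+ (h - l) * (stirling1 h l)%:R * x ^+ l)).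
  rewrite (@big_cat_nat _ _ _ h.+1) //= big_mkord [X in _ + X]big_nat [X in _ + X]big1 ?addr0// => l.
  by move=> /andP[hl _]; rewrite stirling1_small// mulr0 mul0r.
elim: h {N hN} => [|h IH]; first by rewrite /falling big_ord0 big_ord_recl big_ord0 /= subnn expr0 !mulr1 addr0.
rewrite fallingS IH mulrBr [RHS]big_ord_recl /= mulr0 mul0r add0r.
under [RHS]eq_bigr do rewrite /bump leq0n add1n subSS natrD mulrDr mulrDl.
rewrite big_split /= [RHS]addrC; congr (_ + _).
  by rewrite big_distrl /=; apply: eq_bigr => l _; rewrite exprSr mulrA.
rewrite [RHS]big_ord_recr /= stirling1_small// muln0 mulr0 mul0r addr0.
rewrite big_ord_recl /= mulrDl opprD.
have -> : (-1) ^+ (h - 0) * (stirling1 h 0)%:R * x ^+ 0 * h%:R = 0 :> F.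
  by case: h {IH} => [|h] /=; rewrite ?mulr0 ?mul0r.
rewrite oppr0 add0r big_distrl -sumrN /=; apply: eq_bigr => l _.
rewrite /bump leq0n add1n natrM (_ : (h - l = (h - l.+1).+1)%N); last first.
  by rewrite subnSK.
by rewrite [(-1) ^+ (h - l.+1).+1]exprS; ring.
Qed.

Lemma gbinom_falling x k : gbinom x k = falling x k / k`!%:R.
Proof. by []. Qed.

Lemma factr_neq0 k : k`!%:R != 0 :> F.
Proof. by rewrite pnatr_eq0 -lt0n fact_gt0. Qed.

Lemma gbinom_nat n k : gbinom n%:R k = 'C(n, k)%:R :> F.
Proof.
rewrite gbinom_falling falling_nat -bin_ffact natrM mulfK ?factr_neq0//.
Qed.

Lemma gbinomS x k : k.+1%:R * gbinom x k.+1 = x * gbinom (x - 1) k.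
Proof.
rewrite !gbinom_falling fallingSl factS natrM; field.
by rewrite factr_neq0 nat1r pnatr_eq0.
Qed.

(** Multiply by n+1 = k + (n+1-k) and absorb the factors k and n+1-k into the two
binomial coefficients; this lowers n. *)
Lemma gbinom_Vandermonde x y n :
  \sum_(k < n.+1) gbinom x k * gbinom y (n - k) = gbinom (x + y) n.
Proof.
elim: n x y => [|n IH] x y.
  by rewrite big_ord_recl big_ord0 /= !gbinom_falling /falling !big_ord0 fact0 divr1 mulr1 addr0.
apply: (@mulfI _ n.+1%:R); first by rewrite pnatr_eq0.
rewrite gbinomS.
transitivity (\sum_(k < n.+2) (k%:R * gbinom x k * gbinom y (n.+1 - k)) +
   \sum_(k < n.+2) (gbinom x k * ((n.+1 - k)%:R * gbinom y (n.+1 - k)))).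
  rewrite big_distrr -big_split /=; apply: eq_bigr => k _.
  by rewrite natrB -1?ltnS//; ring.
rewrite big_ord_recl mul0r mul0r add0r [X in _ + X]big_ord_recr /= subnn mul0r mulr0 addr0.
have -> : \sum_(i < n.+1) (bump 0 i)%:R * gbinom x (bump 0 i) * gbinom y (n.+1 - bump 0 i)
  = x * gbinom (x - 1 + y) n.
  rewrite -IH big_distrr /=; apply: eq_bigr => i _.
  by rewrite /bump leq0n add1n subSS gbinomS; ring.
have -> : \sum_(i < n.+1) gbinom x i * ((n.+1 - i)%:R * gbinom y (n.+1 - i))
  = y * gbinom (x + (y - 1)) n.
  rewrite -IH big_distrr /=; apply: eq_bigr => i _.
  by rewrite subSn -1?ltnS// gbinomS; ring.
by rewrite mulrDl; congr (_ * gbinom _ _ + _ * gbinom _ _); ring.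
Qed.

(** Choosing h + j elements and ordering h of them amounts to ordering h elements
and choosing j of the others. *)
Lemma falling_gbinom x h j :
  ((h + j) ^_ h)%:R * gbinom x (h + j) = falling x h * gbinom (x - h%:R) j.
Proof.
elim: h x => [|h IH] x; first by rewrite /falling big_ord0 add0n ffactn0 subr0.
rewrite addSn ffactSS natrM mulrAC gbinomS fallingSl.
transitivity (x * (((h + j) ^_ h)%:R * gbinom (x - 1) (h + j))); first by ring.
by rewrite IH -nat1r opprD addrA mulrA.
Qed.

Lemma sum_falling m h (G : nat -> F) : (h <= m)%N ->
  \sum_(k < m.+1) (k ^_ h)%:R * G k = \sum_(j < (m - h).+1) ((h + j) ^_ h)%:R * G (h + j)%N.
Proof.
move=> hm; rewrite -(big_mkord xpredT (fun k => (k ^_ h)%:R * G k)).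
rewrite (@big_cat_nat _ _ _ h) ?leqW//= [X in X + _]big_nat [X in X + _]big1 ?add0r; last first.
  by move=> k /andP[_ kh]; rewrite ffact_small// mul0r.
rewrite -{1}[h]add0n big_addn subSn// big_mkord.
by apply: eq_bigr => j _; rewrite addnC.
Qed.

Lemma sum_falling0 m h (G : nat -> F) : (m < h)%N ->
  \sum_(k < m.+1) (k ^_ h)%:R * G k = 0.
Proof.
move=> mh; rewrite big1// => k _; rewrite ffact_small ?mul0r//.
exact: leq_trans (ltn_ord k) mh.
Qed.

(** After falling_gbinom the sum is a Vandermonde convolution.  The formula also
covers m < h, when both sides vanish. *)
Lemma factorial_moment_without x y m h T : x + y = T%:R -> (m <= T)%N ->
  \sum_(k < m.+1) (k ^_ h)%:R * (gbinom x k * gbinom y (m - k) / gbinom (x + y) m)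
  = 'C(m, h)%:R / 'C(T, h)%:R * falling x h.
Proof.
move=> xyT mT; have [hm|mh] := leqP h m; last first.
  rewrite (sum_falling0 (fun k => gbinom x k * gbinom y (m - k) / gbinom (x + y) m))//.
  by rewrite bin_small// !mul0r.
rewrite (sum_falling (fun k => gbinom x k * gbinom y (m - k) / gbinom (x + y) m))//.
have -> : \sum_(j < (m - h).+1) ((h + j) ^_ h)%:R *
    (gbinom x (h + j) * gbinom y (m - (h + j)) / gbinom (x + y) m) =
  falling x h * gbinom (x + y - h%:R) (m - h) / gbinom (x + y) m.
  have -> : x + y - h%:R = x - h%:R + y by ring.
  rewrite -(gbinom_Vandermonde (x - h%:R)) big_distrr big_distrl /=.
  apply: eq_bigr => j _; rewrite subnDA.
  transitivity (((h + j) ^_ h)%:R * gbinom x (h + j) * gbinom y (m - h - j) / gbinom (x + y) m).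
    by ring.
  by rewrite falling_gbinom; ring.
rewrite xyT gbinom_nat.
have := falling_gbinom T%:R h (m - h).
rewrite subnKC// gbinom_nat falling_nat -!bin_ffact !natrM.
have hf : h`!%:R != 0 :> F := factr_neq0 h.
have hT : 'C(T, h)%:R != 0 :> F by rewrite pnatr_eq0 -lt0n bin_gt0 (leq_trans hm).
have mT' : 'C(T, m)%:R != 0 :> F by rewrite pnatr_eq0 -lt0n bin_gt0.
set g := gbinom _ _ => E.
have -> : g = 'C(m, h)%:R * 'C(T, m)%:R / 'C(T, h)%:R.
  apply: (mulfI hT); apply: (mulfI hf); rewrite mulrCA mulrA -E; field.
  exact: hT.
by field; rewrite hT mT'.
Qed.

(** After falling_gbinom for the binomial coefficients of m, the sum is a binomial
expansion. *)
Lemma factorial_moment_with x y m h (t : F) : x + y = t -> t != 0 ->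
  \sum_(k < m.+1) (k ^_ h)%:R * ('C(m, k)%:R * x ^+ k * y ^+ (m - k) / t ^+ m)
  = (m ^_ h)%:R / t ^+ h * x ^+ h.
Proof.
move=> xyt t0; have [hm|mh] := leqP h m; last first.
  rewrite (sum_falling0 (fun k => 'C(m, k)%:R * x ^+ k * y ^+ (m - k) / t ^+ m))//.
  by rewrite ffact_small// !mul0r.
rewrite (sum_falling (fun k => 'C(m, k)%:R * x ^+ k * y ^+ (m - k) / t ^+ m))//.
have -> : \sum_(j < (m - h).+1) ((h + j) ^_ h)%:R *
    ('C(m, h + j)%:R * x ^+ (h + j) * y ^+ (m - (h + j)) / t ^+ m) =
  (m ^_ h)%:R * x ^+ h * (x + y) ^+ (m - h) / t ^+ m.
  rewrite addrC exprDn big_distrr big_distrl /=.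
  apply: eq_bigr => j _; rewrite subnDA exprD -mulr_natr.
  have := falling_gbinom m%:R h j; rewrite -natrB// !gbinom_nat falling_nat => E.
  transitivity (((h + j) ^_ h)%:R * 'C(m, h + j)%:R * x ^+ h * x ^+ j * y ^+ (m - h - j) / t ^+ m).
    by ring.
  by rewrite E; ring.
have -> : t ^+ m = t ^+ (m - h) * t ^+ h by rewrite -exprD subnK.
rewrite xyt; field.
by rewrite !expf_neq0.
Qed.

End FallingFactorial.

(** * One draw of the urn *)

Arguments pcoef : simpl never.

Section DrawMoments.
Context {R : realType} (U : urn).
Local Notation m := (sample_size U).
Implicit Types (md : model) (n i l s r : nat).

Lemma pcoef_small md n i l : (i < l)%N -> pcoef U R md n i l = 0.
Proof.
rewrite /pcoef; case: md => il; last by rewrite stirling2_small// !mul0r.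
by rewrite big_geq//; apply: (leq_ltn_trans _ il); exact: geq_minl.
Qed.

(** The terms outside l <= h <= min(i, m) vanish, which makes the range of summation
independent of l. *)
Lemma pcoef_withoutE n i l :
  pcoef U R without_replacement n i l =
  \sum_(h < i.+1) (-1) ^+ (h - l) * (stirling1 h l)%:R * (stirling2 i h)%:R *
    'C(m, h)%:R / 'C(Defs.total U n.-1, h)%:R.
Proof.
rewrite /pcoef.
set G := fun h => (-1) ^+ (h - l) * (stirling1 h l)%:R * (stirling2 i h)%:R *
    'C(m, h)%:R / 'C(Defs.total U n.-1, h)%:R : R.
rewrite -(big_mkord xpredT G).
have [li|il] := leqP l (minn i m).
  rewrite [RHS](@big_cat_nat _ _ _ l) ?(leqW (leq_trans li (geq_minl _ _)))//=.
  rewrite [X in _ = X + _]big_nat [X in _ = X + _]big1 ?add0r; last first.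
    by move=> h /andP[_ hl]; rewrite /G stirling1_small// mulr0 !mul0r.
  rewrite [RHS](@big_cat_nat _ _ _ (minn i m).+1) ?(leqW li) ?ltnS ?geq_minl//=.
  rewrite [X in _ = _ + X]big_nat [X in _ = _ + X]big1 ?addr0// => h /andP[mh hi].
  rewrite /G [in 'C(m, h)]bin_small ?mulr0 ?mul0r//.
  by move: mh; rewrite gtn_min => /orP[]// /(leq_trans hi); rewrite ltnn.
rewrite [LHS]big_geq// [RHS]big_nat [RHS]big1// => h /andP[_ hi].
move: il; rewrite gtn_min => /orP[il|ml].
  by rewrite /G stirling1_small ?mulr0 ?mul0r// (leq_trans hi).
have [hl|lh] := ltnP h l; first by rewrite /G stirling1_small ?mulr0 ?mul0r.
by rewrite /G [in 'C(m, h)]bin_small ?mulr0 ?mul0r// (leq_trans ml).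
Qed.

(** The meaning of p_(n;(i,l)): it is the coefficient of W^l in the i-th moment of
the number of white balls in a sample. *)
Lemma draw_moment md n i (w b : int) : (0 < m)%N ->
  w + b = (Defs.total U n.-1)%:Z -> (m <= Defs.total U n.-1)%N ->
  \sum_(k < m.+1) draw_prob U R md w b k * k%:R ^+ i =
  \sum_(l < i.+1) pcoef U R md n i l * w%:~R ^+ l.
Proof.
move=> m0 wbT mT.
have wbR : w%:~R + b%:~R = (Defs.total U n.-1)%:R :> R by rewrite -intrD wbT.
have T0 : (Defs.total U n.-1)%:R != 0 :> R by rewrite pnatr_eq0 -lt0n (leq_trans m0).
pose F h := \sum_(k < m.+1) (k ^_ h)%:R * draw_prob U R md w b k.
transitivity (\sum_(h < i.+1) (stirling2 i h)%:R * F h).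
  under [RHS]eq_bigr do rewrite big_distrr /=.
  rewrite exchange_big /=; apply: eq_bigr => k _.
  rewrite -natrX expn_stirling2 natr_sum big_distrr /=.
  by apply: eq_bigr => h _; rewrite natrM; ring.
case: md @F => F.
  have FE h : F h = 'C(m, h)%:R / 'C(Defs.total U n.-1, h)%:R * falling w%:~R h.
    rewrite -(@factorial_moment_without _ _ b%:~R)//.
    by apply: eq_bigr => k _; rewrite /draw_prob intrD.
  under eq_bigr => h _ do
    rewrite FE (@falling_stirling1 _ _ h i) -1?ltnS// !big_distrr /=.
  rewrite exchange_big /=; apply: eq_bigr => l _.
  rewrite pcoef_withoutE big_distrl /=; apply: eq_bigr => h _.
  by ring.
have FE h : F h = (m ^_ h)%:R / (Defs.total U n.-1)%:R ^+ h * w%:~R ^+ h.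
  rewrite -(@factorial_moment_with _ _ b%:~R _ _ _ wbR T0).
  by apply: eq_bigr => k _; rewrite /draw_prob intrD wbR.
by apply: eq_bigr => h _; rewrite FE /pcoef; ring.
Qed.

(** The two inner sums of f_(n,s,r).  They give the coefficient of y^q in the mean of
(sigma k / m + a_m / (Lambda - 1))^j, where W = y + a_m (n-1) / (1 - Lambda). *)
Definition inner_coef md n j q : R :=
  \sum_(q <= l < j.+1) 'C(l, q)%:R *
      ((add_white U m)%:~R * n.-1%:R / (1 - Lambda U R)) ^+ (l - q) *
      \sum_(l <= i < j.+1) 'C(j, i)%:R * ((balance U)%:R / m%:R) ^+ i *
        ((add_white U m)%:~R / (Lambda U R - 1)) ^+ (j - i) * pcoef U R md n i l.

Lemma fcoef_inner md n s r : (r <= s)%N ->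
  fcoef U R md n s r =
  \sum_(s - r <= j < s.+1) 'C(s, j)%:R * Lambda U R ^+ j * inner_coef md n j (j - (s - r)).
Proof.
move=> rs; rewrite /fcoef; apply: eq_big_nat => j /andP[srj js].
congr (_ * _); apply: eq_big_nat => l /andP[jl lj].
congr (_ * _ ^+ _ * _); by rewrite subnBA.
Qed.

Lemma big_ord_from (F : nat -> R) q j : (q <= j)%N ->
  (forall l, (l < q)%N -> F l = 0) ->
  \sum_(l < j) F l = \sum_(q <= l < j) F l.
Proof.
move=> qj F0; rewrite -(big_mkord xpredT F) (@big_cat_nat _ _ _ q)//=.
by rewrite [X in X + _]big_nat [X in X + _]big1 ?add0r// => l /andP[_ /F0].
Qed.

Lemma inner_coef_poly md n j (y c : R) :
  c = (add_white U m)%:~R * n.-1%:R / (1 - Lambda U R) ->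
  \sum_(i < j.+1) 'C(j, i)%:R * ((balance U)%:R / m%:R) ^+ i *
        ((add_white U m)%:~R / (Lambda U R - 1)) ^+ (j - i) *
    (\sum_(l < i.+1) pcoef U R md n i l * (y + c) ^+ l) =
  \sum_(q < j.+1) inner_coef md n j q * y ^+ q.
Proof.
move=> cE.
set B := fun i => 'C(j, i)%:R * ((balance U)%:R / m%:R) ^+ i *
        ((add_white U m)%:~R / (Lambda U R - 1)) ^+ (j - i) : R.
have ext i : (i < j.+1)%N -> \sum_(l < i.+1) pcoef U R md n i l * (y + c) ^+ l =
    \sum_(l < j.+1) pcoef U R md n i l * (y + c) ^+ l.
  move=> ij; rewrite -!(big_mkord xpredT (fun l => pcoef U R md n i l * (y + c) ^+ l)).
  rewrite [RHS](@big_cat_nat _ _ _ i.+1)//= [X in _ = _ + X]big_nat [X in _ = _ + X]big1 ?addr0//.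
  by move=> l /andP[il _]; rewrite pcoef_small// mul0r.
under eq_bigr => i _ do rewrite (ext i (ltn_ord i)) big_distrr /=.
rewrite exchange_big /=.
have innerE q : (q <= j)%N -> inner_coef md n j q =
   \sum_(l < j.+1) 'C(l, q)%:R * c ^+ (l - q) * \sum_(i < j.+1) B i * pcoef U R md n i l.
  move=> qj.
  rewrite (big_ord_from (F := fun l => 'C(l, q)%:R * c ^+ (l - q) * \sum_(i < j.+1) B i * pcoef U R md n i l) (q := q))//; last 2 first.
  - exact: leqW.
  - by move=> l lq; rewrite bin_small// !mul0r.
  rewrite /inner_coef -cE; apply: eq_big_nat => l /andP[ql lj].
  congr (_ * _).
  rewrite (big_ord_from (F := fun i => B i * pcoef U R md n i l) (q := l))//; first exact: ltnW.
  by move=> i il; rewrite pcoef_small// mulr0.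
under [RHS]eq_bigr => q _ do rewrite innerE -1?ltnS// big_distrl /=.
rewrite [RHS]exchange_big /=; apply: eq_bigr => l _.
have -> : (y + c) ^+ l = \sum_(q < j.+1) 'C(l, q)%:R * c ^+ (l - q) * y ^+ q.
  rewrite addrC exprDn -!(big_mkord xpredT (fun q => 'C(l, q)%:R * c ^+ (l - q) * y ^+ q)).
  rewrite [RHS](@big_cat_nat _ _ _ l.+1)//=.
  rewrite [X in _ = _ + X]big_nat [X in _ = _ + X]big1 ?addr0; last first.
    by move=> q /andP[lq _]; rewrite bin_small// !mul0r.
  by rewrite big_mkord; apply: eq_bigr => q _; rewrite -mulr_natl mulrA.
transitivity ((\sum_(i < j.+1) B i * pcoef U R md n i l) *
   (\sum_(q < j.+1) 'C(l, q)%:R * c ^+ (l - q) * y ^+ q)).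
  by rewrite [RHS]big_distrl /=; apply: eq_bigr => i _; rewrite mulrA.
by rewrite big_distrr /=; apply: eq_bigr => q _; ring.
Qed.

(** Collects the terms of total degree r in y: those with j >= s - r, each of which
contributes its coefficient of degree j - (s - r). *)
Lemma fcoef_poly md n s (y : R) (H : nat -> R) :
  (forall j, (j <= s)%N -> H j = \sum_(q < j.+1) inner_coef md n j q * y ^+ q) ->
  \sum_(j < s.+1) 'C(s, j)%:R * Lambda U R ^+ j * y ^+ (s - j) * H j =
  \sum_(r < s.+1) fcoef U R md n s r * y ^+ r.
Proof.
move=> HE.
(* The summand of index (r, j), extended by 0 to a square of indices. *)
pose G r j : R := if (s - r <= j)%N then
  'C(s, j)%:R * Lambda U R ^+ j * inner_coef md n j (j - (s - r)) * y ^+ r else 0.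
transitivity (\sum_(r < s.+1) \sum_(j < s.+1) G r j); last first.
  apply: eq_bigr => r _; rewrite fcoef_inner -1?ltnS// big_distrl /=.
  rewrite (big_ord_from (F := G r) (q := (s - r)%N)) ?leqW ?leq_subr//.
    by apply: eq_big_nat => j /andP[srj _]; rewrite /G srj.
  by move=> j; rewrite /G ltnNge => /negbTE ->.
rewrite exchange_big /=; apply: eq_bigr => j _.
have js : (j <= s)%N by rewrite -ltnS.
rewrite HE//.
rewrite (big_ord_from (F := fun r => G r j) (q := (s - j)%N)) ?leqW ?leq_subr//; last first.
  by move=> r rsj; rewrite /G ifF//; apply/negbTE; rewrite -ltnNge; lia.
rewrite -[X in \sum_(X <= _ < _) _]add0n big_addn.
have -> : (s.+1 - (s - j) = j.+1)%N by lia.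
rewrite big_mkord big_distrr /=; apply: eq_bigr => q _.
have qj : (q <= j)%N by rewrite -ltnS.
rewrite /G ifT; last by lia.
have -> : (j - (s - (q + (s - j))) = q)%N by lia.
by rewrite exprD; ring.
Qed.

(** For r = s only l = j and i = j survive in the inner sums. *)
Lemma fcoef_diag md n s :
  fcoef U R md n s s =
  \sum_(j < s.+1) 'C(s, j)%:R * Lambda U R ^+ j * ((balance U)%:R / m%:R) ^+ j * pcoef U R md n j j.
Proof.
rewrite fcoef_inner// subnn big_mkord; apply: eq_bigr => j _.
rewrite subn0 /inner_coef big_nat1 big_nat1 subnn !expr0 binn.
by ring.
Qed.

Lemma pcoef_diag md n j : (sample_size U <= Defs.total U n.-1)%N ->
  pcoef U R md n j j =
  match md with
  | without_replacement => 'C(m, j)%:R / 'C(Defs.total U n.-1, j)%:R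
  | with_replacement => (m ^_ j)%:R / (Defs.total U n.-1)%:R ^+ j
  end.
Proof.
move=> mT; case: md; last by rewrite /pcoef stirling2_nn mul1r.
rewrite pcoef_withoutE big_ord_recr /= big1 ?add0r; last first.
  by move=> h _; rewrite stirling1_small ?mulr0 ?mul0r.
by rewrite subnn expr0 stirling1_nn stirling2_nn !mul1r.
Qed.

Lemma pcoef00 md n : pcoef U R md n 0 0 = 1.
Proof.
rewrite /pcoef; case: md => /=; last by rewrite ffactn0 expr0 divr1 mulr1.
by rewrite min0n big_nat1 expr0 !bin0 !mul1r invr1.
Qed.

Lemma pcoefS0 md n i : pcoef U R md n i.+1 0 = 0.
Proof.
case: md; last by rewrite /pcoef !mul0r.
by rewrite pcoef_withoutE big1// => -[[|h] hh] _ /=; rewrite ?mulr0 ?mul0r.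
Qed.

(** The meaning of f_(n,s,r): it is the coefficient of y^r in the mean of the s-th
power after one draw, where y is the centred number of white balls. *)
Lemma step_moment md n s (w b : int) (y : R) : (0 < m)%N ->
  w + b = (Defs.total U n.-1)%:Z -> (m <= Defs.total U n.-1)%N ->
  w%:~R = y + (add_white U m)%:~R * n.-1%:R / (1 - Lambda U R) ->
  \sum_(k < m.+1) draw_prob U R md w b k *
    (y + Lambda U R * ((balance U)%:R / m%:R * k%:R + (add_white U m)%:~R / (Lambda U R - 1))) ^+ s
  = \sum_(r < s.+1) fcoef U R md n s r * y ^+ r.
Proof.
move=> m0 wbT mT wy.
set e := (add_white U m)%:~R / (Lambda U R - 1).
set ka := (balance U)%:R / m%:R : R.
pose H j := \sum_(k < m.+1) draw_prob U R md w b k * (ka * k%:R + e) ^+ j.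
rewrite -(@fcoef_poly md n s y H); last first.
  move=> j js; rewrite -(inner_coef_poly md j y (erefl _)) /H.
  under eq_bigr => k _ do rewrite addrC exprDn big_distrr /=.
  rewrite exchange_big /=; apply: eq_bigr => i _.
  rewrite -wy -(draw_moment md i m0 wbT mT) big_distrr /=.
  by apply: eq_bigr => k _; rewrite -/ka -/e -[_ *+ 'C(_, _)]mulr_natl [(ka * _) ^+ _]exprMn; ring.
under [RHS]eq_bigr => j _ do rewrite /H big_distrr /=.
rewrite [RHS]exchange_big /=; apply: eq_bigr => k _.
rewrite exprDn big_distrr /=; apply: eq_bigr => j _.
by rewrite -[_ *+ 'C(_, _)]mulr_natl [(Lambda U R * _) ^+ _]exprMn; ring.
Qed.

End DrawMoments.

(** * Expectations over histories *)

Section Expectation.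
Context {R : realType} (d : measure_display) (T : measurableType d).
Variable P : probability T R.

Lemma integral_sum_indic (I : Type) (s : seq I) (A : I -> set T) (F : I -> R) :
  (forall i, measurable (A i)) ->
  P.-integrable setT (EFin \o (fun x => \sum_(i <- s) F i * \1_(A i) x)) /\
  (\int[P]_x (\sum_(i <- s) F i * \1_(A i) x)%:E = (\sum_(i <- s) F i * fine (P (A i)))%:E)%E.
Proof.
move=> mA; elim: s => [|i s [IH1 IH2]].
  split.
    apply: (eq_integrable measurableT (fun=> 0%:E)); last exact: integrable0.
    by move=> x _; rewrite /= big_nil.
  under eq_integral do rewrite big_nil.
  by rewrite integral0 big_nil.
have i1 : P.-integrable setT (EFin \o (\1_(A i) : T -> R)).
  by apply: integrable_indic => //; rewrite -ge0_fin_numE// fin_num_measure.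
have i2 : P.-integrable setT (fun x => (F i)%:E * (\1_(A i) x)%:E)%E.
  exact: integrableZl.
have E x : (\sum_(j <- i :: s) F j * \1_(A j) x)%:E =
    ((F i)%:E * (\1_(A i) x)%:E + (\sum_(j <- s) F j * \1_(A j) x)%:E)%E.
  by rewrite big_cons EFinD EFinM.
split.
  have := integrableD measurableT i2 IH1.
  by apply: eq_integrable => // x _; rewrite /= -E.
under eq_integral do rewrite E.
rewrite integralD// IH2 integralZl// integral_indic// setIT big_cons EFinD EFinM.
by rewrite fineK// fin_num_measure.
Qed.

End Expectation.

Section History.
Context {R : realType} (d : measure_display) (T : measurableType d).
Variables (P : probability T R) (md : model) (U : urn) (K : nat -> {RV P >-> nat}).
Hypothesis hK : urn_process U md K.
Local Notation m := (sample_size U).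

Definition history n x := mkseq (fun i => K i x) n.

Lemma historyS n x : history n.+1 x = rcons (history n x) (K n x).
Proof. by rewrite /history mkseqS. Qed.

Definition history_event (h : seq nat) : set T := [set x | history (size h) x = h].

Lemma history_event_rcons h k :
  history_event (rcons h k) = [set x | history (size h) x = h /\ K (size h) x = k].
Proof.
apply/seteqP; split => x; rewrite /history_event /= size_rcons historyS.
  by move/eqP; rewrite eqseq_rcons => /andP[/eqP -> /eqP ->].
by move=> [-> ->].
Qed.

Lemma measurable_history_event h : measurable (history_event h).
Proof.
elim/last_ind: h => [|h k IH].
  by rewrite (_ : history_event [::] = setT)//; apply/seteqP; split.
rewrite history_event_rcons.
have -> : [set x | history (size h) x = h /\ K (size h) x = k] =
  history_event h `&` (K (size h) @^-1` [set k]) by [].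
by apply: measurableI => //; rewrite -[X in measurable X]setTI; apply: measurable_funP.
Qed.

Definition history_prob h : R := fine (P (history_event h)).

Lemma history_prob_nil : history_prob [::] = 1.
Proof.
rewrite /history_prob (_ : history_event [::] = setT) ?probability_setT//.
by apply/seteqP; split.
Qed.

Lemma history_prob_rcons h k : (k <= m)%N ->
  history_prob (rcons h k) =
  history_prob h * draw_prob U R md (white_after U h) (black_after U h) k.
Proof.
move=> km; rewrite /history_prob history_event_rcons (hK.2 h k km) fineM//.
exact: fin_num_measure (measurable_history_event h).
Qed.

(** All sequences of sample compositions of length n, also those of probability 0. *)
Fixpoint histories n : seq (seq nat) :=
  if n is n'.+1 then [seq rcons h k | h <- histories n', k <- iota 0 m.+1]
  else [:: [::]].

Lemma mem_histories n h : h \in histories n.+1 ->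
  exists h' k, [/\ h' \in histories n, (k <= m)%N & h = rcons h' k].
Proof.
move=> /(@allpairsP _ _ _ rcons (histories n) (iota 0 m.+1) h)[[h' k] [h1 h2 ->]].
by exists h', k; split=> //; move: h2; rewrite mem_iota.
Qed.

Lemma histories_size n h : h \in histories n -> size h = n.
Proof.
elim: n h => [|n IH] h; first by rewrite inE => /eqP ->.
by move=> /mem_histories[h' [k [/IH <- _ ->]]]; rewrite size_rcons.
Qed.

Lemma histories_le n h : h \in histories n -> all (leq^~ m) h.
Proof.
elim: n h => [|n IH] h; first by rewrite inE => /eqP ->.
by move=> /mem_histories[h' [k [/IH h1 h2 ->]]]; rewrite all_rcons h1 andbT.
Qed.

Lemma histories_uniq n : uniq (histories n).
Proof.
elim: n => [//|n IH]; apply: allpairs_uniq => //; first exact: iota_uniq.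
move=> [h k] [h' k'] _ _ /= /eqP; rewrite eqseq_rcons.
by move=> /andP[/eqP -> /eqP ->].
Qed.

Lemma history_in n x : history n x \in histories n.
Proof.
elim: n => [//|n IH]; rewrite historyS.
apply/(@allpairsP _ _ _ rcons (histories n) (iota 0 m.+1)).
exists (history n x, K n x); split=> //.
by rewrite mem_iota add0n ltnS hK.1.
Qed.

Definition mean n (F : seq nat -> R) : R := \sum_(h <- histories n) F h * history_prob h.

(** A function of the first n draws is a finite combination of indicators. *)
Lemma expectation_history n (F : seq nat -> R) :
  fine ('E_P[fun x => F (history n x)])%E = mean n F.
Proof.
have [_ h2] := integral_sum_indic P (histories n) F measurable_history_event.
rewrite unlock -[RHS]/(fine (mean n F)%:E) -h2; congr fine.
apply: eq_integral => x _; congr (_%:E).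
rewrite (bigD1_seq (history n x)) ?history_in ?histories_uniq//=.
rewrite big1_seq ?addr0; last first.
  move=> h /andP[hx hn]; rewrite indicE memNset ?mulr0//.
  by rewrite /history_event /= (histories_size hn) => /eqP; rewrite eq_sym (negbTE hx).
by rewrite indicE mem_set ?mulr1// /history_event /= size_mkseq.
Qed.

Lemma meanS n (F : seq nat -> R) :
  mean n.+1 F = mean n (fun h => \sum_(k < m.+1)
    draw_prob U R md (white_after U h) (black_after U h) k * F (rcons h k)).
Proof.
rewrite /mean big_allpairs_dep; apply: eq_bigr => h _.
have -> : iota 0 m.+1 = index_iota 0 m.+1 by rewrite /index_iota subn0.
rewrite big_distrl big_mkord; apply: eq_bigr => k _ /=.
have km : (k <= m)%N by rewrite -ltnS.
by rewrite history_prob_rcons//; ring.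
Qed.

Lemma mean0 (F : seq nat -> R) : mean 0 F = F [::].
Proof. by rewrite /mean big_seq1 history_prob_nil mulr1. Qed.

Lemma eq_mean n (F G : seq nat -> R) :
  (forall h, size h = n -> all (leq^~ m) h -> F h = G h) -> mean n F = mean n G.
Proof.
move=> FG; apply: eq_big_seq => h hn.
by rewrite FG ?(histories_size hn) ?(histories_le hn).
Qed.

Hypothesis hU : urn_assumptions U R md.

Definition centred (h : seq nat) : R :=
  (white_after U h)%:~R - (add_white U m)%:~R / (1 - Lambda U R) * (size h)%:R.

Lemma total_after h : all (leq^~ m) h ->
  white_after U h + black_after U h = (Defs.total U (size h))%:Z.
Proof.
have [[_ _ bal _ _] _] := hU.
rewrite /white_after /black_after /Defs.total /total0.
elim: h => [|k h IH] /=; first by rewrite !big_nil muln0; lia.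
move=> /andP[km /IH]; rewrite !big_cons mulnS.
have := bal (m - k)%N (leq_subr _ _).
move: (\sum_(j <- h) _) (\sum_(j <- h) _) (add_white U (m - k)%N) (add_black U (m - k)%N) => p q r t.
move: (balance U * size h)%N => v; lia.
Qed.

(** This is where the urn has to be affine.  For a_m = 0 both quotients by
1 - Lambda are 0, also if Lambda = 1. *)
Lemma centred_rcons h k : (k <= m)%N -> add_white U m = 0 \/ Lambda U R != 1 ->
  centred (rcons h k) = centred h + Lambda U R *
    ((balance U)%:R / m%:R * k%:R + (add_white U m)%:~R / (Lambda U R - 1)).
Proof.
have [[m0 s0 _ aff _] _] := hU.
move=> km am; rewrite /centred size_rcons -natr1 /white_after.
rewrite -cats1 big_cat big_seq1 /=.
rewrite (aff (m - k)%N (leq_subr _ _)) subKn//.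
have m0' : m%:R != 0 :> R by rewrite pnatr_eq0 -lt0n.
have s0' : (balance U)%:R != 0 :> R by rewrite pnatr_eq0 -lt0n.
rewrite !rmorphD /= rmorphM /=.
set a := (add_white U m)%:~R.
set D := (add_white U m.-1 - add_white U m)%:~R : R.
have LE : Lambda U R * ((balance U)%:R / m%:R * k%:R) = k%:R * D.
  by rewrite /Lambda -/D; field; rewrite m0' s0'.
rewrite [Lambda U R * (_ + _)]mulrDr LE.
case: am => [a0|L1].
  by rewrite /a a0 !mul0r; ring.
have L0 : 1 - Lambda U R != 0 by rewrite subr_eq0 eq_sym.
have L2 : Lambda U R - 1 != 0 by rewrite subr_eq0.
rewrite (_ : Lambda U R - 1 = - (1 - Lambda U R)); last by rewrite opprB.
by field; rewrite L0.
Qed.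

End History.

(** * The moment recursion and its coefficients *)

Section MomentRecursion.
Context {R : realType} (d : measure_display) (T : measurableType d).
Variables (P : probability T R) (md : model) (U : urn) (K : nat -> {RV P >-> nat}).
Hypothesis hK : urn_process U md K.
Hypothesis hU : urn_assumptions U R md.
Hypothesis hL : add_white U (sample_size U) = 0 \/ Lambda U R != 1.
Local Notation m := (sample_size U).

Lemma sample_le_total n : (m <= Defs.total U n)%N.
Proof. by have [_ h] := hU; apply: leq_trans h _; rewrite /Defs.total leq_addr. Qed.

Lemma moment_mean s n :
  moment U K s n = mean U K n (fun h => centred U h ^+ s).
Proof.
rewrite -(expectation_history hK); congr (fine ('E_P[_])%E).
by apply/funext => x; rewrite /centred /history size_mkseq.
Qed.

Lemma moment0 s : moment U K s 0 = (white0 U)%:R ^+ s.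
Proof.
rewrite moment_mean mean0 /centred /= mulr0 subr0 /white_after big_nil addr0.
by [].
Qed.

Lemma momentS s n :
  moment U K s n.+1 = \sum_(r < s.+1) fcoef U R md n.+1 s r * moment U K r n.
Proof.
have [[m0 s0 _ _ _] _] := hU.
rewrite moment_mean (meanS hK).
transitivity (mean U K n (fun h => \sum_(r < s.+1) fcoef U R md n.+1 s r * centred U h ^+ r)).
  apply: eq_mean => h hn hm.
  have wb := total_after hU hm.
  rewrite hn in wb.
  rewrite -(@step_moment R U md n.+1 s _ _ (centred U h) m0 wb (sample_le_total n)); last first.
    by rewrite /centred hn /=; ring.
  apply: eq_bigr => k _; have km : (k <= m)%N by rewrite -ltnS.
  by rewrite (centred_rcons hU _ km hL).
under [RHS]eq_bigr do rewrite moment_mean.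
rewrite /mean; under [LHS]eq_bigr do rewrite big_distrl /=.
rewrite exchange_big /=; apply: eq_bigr => r _.
by rewrite big_distrr /=; apply: eq_bigr => h _; rewrite mulrA.
Qed.

End MomentRecursion.

Section Decay.
Context {R : realType}.
Implicit Types (u v : nat -> R) (q : nat).

(** u n = O(n^-q), for n >= 1. *)
Definition decays u q := exists B : R, forall n, `|u n.+1| * n.+1%:R ^+ q <= B.

Lemma decays_eq u v q : (forall n, u n.+1 = v n.+1) -> decays u q -> decays v q.
Proof. by move=> uv [B h]; exists B => n; rewrite -uv. Qed.

Lemma decays0 q : decays (fun=> 0) q.
Proof. by exists 0 => n; rewrite normr0 mul0r. Qed.

Lemma decaysD u v q : decays u q -> decays v q -> decays (fun n => u n + v n) q.
Proof.
move=> [A hA] [B hB]; exists (A + B) => n.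
apply: le_trans (lerD (hA n) (hB n)).
by rewrite -mulrDl ler_wpM2r// ler_normD.
Qed.

Lemma decays_sum (I : Type) (r : seq I) (p : pred I) (F : I -> nat -> R) q :
  (forall i, p i -> decays (F i) q) -> decays (fun n => \sum_(i <- r | p i) F i n) q.
Proof.
move=> h; elim: r => [|i r IH].
  by apply: decays_eq (decays0 q) => n; rewrite big_nil.
have [pi|pi] := boolP (p i).
  by apply: decays_eq (decaysD (h i pi) IH) => n; rewrite big_cons pi.
by apply: decays_eq IH => n; rewrite big_cons (negbTE pi).
Qed.

Lemma decaysZ c u q : decays u q -> decays (fun n => c * u n) q.
Proof.
move=> [B h]; exists (`|c| * B) => n.
by rewrite normrM -mulrA ler_wpM2l.
Qed.

Lemma decaysW u q q' : (q' <= q)%N -> decays u q -> decays u q'.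
Proof.
move=> qq [B h]; exists B => n; apply: le_trans (h n); rewrite ler_wpM2l//.
by rewrite ler_weXn2l// ler1n.
Qed.

(** A factor of order n^k costs k orders of decay. *)
Lemma decays_grow c u q k : decays u (k + q) ->
  decays (fun n => (c * n.-1%:R) ^+ k * u n) q.
Proof.
move=> [B h]; exists (`|c| ^+ k * B) => n.
rewrite normrM normrX normrM exprMn -!mulrA ler_wpM2l ?exprn_ge0//.
apply: le_trans (h n); rewrite mulrCA ler_wpM2l// exprD ler_wpM2r ?exprn_ge0//.
by rewrite lerXn2r ?nnegrE//= normr_nat ler_nat.
Qed.

Lemma decays_inv_expn (f : nat -> nat) q : (forall n, (n.+1 <= f n.+1)%N) ->
  decays (fun n => ((f n)%:R ^+ q)^-1) q.
Proof.
move=> fn; exists 1 => n.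
have f0 : 0 < (f n.+1)%:R :> R by rewrite ltr0n (leq_trans _ (fn n)).
rewrite ger0_norm ?invr_ge0 ?exprn_ge0// mulrC ler_pdivrMr ?exprn_gt0// mul1r.
by rewrite lerXn2r ?nnegrE// ler_nat.
Qed.

End Decay.

Section CoefficientDecay.
Context {R : realType} (md : model) (U : urn).
Hypothesis hU : urn_assumptions U R md.
Local Notation m := (sample_size U).
Implicit Types (n i l s r j q : nat).

Lemma total_ge n : (n.+1 <= Defs.total U n)%N.
Proof. have [[m0 s0 _ _ _] h] := hU; rewrite /Defs.total; nia. Qed.

(** Every factor t - i with i < m satisfies t <= m (t - i), because m <= t. *)
Lemma expn_le_ffact t h : (h <= m <= t)%N -> (t ^ h <= m ^ h * t ^_ h)%N.
Proof.
elim: h => [//|h IH] /andP[hm mt].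
rewrite ffactnSr expnSr expnSr mulnACA.
by apply: leq_mul; [apply: IH; rewrite ltnW|nia].
Qed.

Lemma decays_bin_ratio h : decays (fun n => ('C(m, h)%:R / 'C(Defs.total U n.-1, h)%:R : R)) h.
Proof.
have [hm|mh] := leqP h m; last first.
  by apply: decays_eq (decays0 h) => n; rewrite bin_small// mul0r.
have [_ mT] := hU.
exists ((m ^_ h)%:R * (m ^ h)%:R) => n /=.
set t := Defs.total U n.
have mt : (m <= t)%N := sample_le_total hU n.
rewrite ger0_norm ?divr_ge0//.
have C0 : 0 < 'C(t, h)%:R :> R by rewrite ltr0n bin_gt0 (leq_trans hm).
rewrite mulrAC ler_pdivrMr// -!natrX -!natrM ler_nat -bin_ffact.
have h1 : (n.+1 ^ h <= m ^ h * ('C(t, h) * h`!))%N.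
  rewrite bin_ffact; apply: leq_trans (expn_le_ffact _); last by rewrite hm.
  case: (h) => [//|h']; rewrite leq_exp2r//; exact: total_ge.
by rewrite -!mulnA leq_mul2l; apply/orP; right; apply: leq_trans h1 _; lia.
Qed.

Lemma decays_pcoef i l : decays (fun n => pcoef U R md n i l) l.
Proof.
case: (md).
  apply: (@decays_eq _ (fun n => \sum_(h < i.+1) (-1) ^+ (h - l) * (stirling1 h l)%:R *
     (stirling2 i h)%:R * ('C(m, h)%:R / 'C(Defs.total U n.-1, h)%:R))).
    by move=> n; rewrite pcoef_withoutE; apply: eq_bigr => h _; rewrite !mulrA.
  apply: decays_sum => h _; have [hl|lh] := ltnP h l.
    by apply: decays_eq (decays0 l) => n; rewrite stirling1_small// mulr0 !mul0r.
  by apply: decaysZ; apply: decaysW lh _; exact: decays_bin_ratio.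
apply: (@decays_eq _ (fun n => (stirling2 i l)%:R * (m ^_ l)%:R *
    (((Defs.total U n.-1)%:R ^+ l)^-1))) => //.
by apply: decaysZ; apply: decays_inv_expn => n; exact: total_ge.
Qed.

(** The power of n in the summand of index l has exponent l - q, while p_(n;(i,l)) is
O(n^-l). *)
Lemma decays_inner_coef j q : decays (fun n => @inner_coef R U md n j q) q.
Proof.
apply: (@decays_eq _ (fun n => \sum_(q <= l < j.+1 | (q <= l < j.+1)%N) 'C(l, q)%:R *
      ((add_white U m)%:~R * n.-1%:R / (1 - Lambda U R)) ^+ (l - q) *
      \sum_(l <= i < j.+1) 'C(j, i)%:R * ((balance U)%:R / m%:R) ^+ i *
        ((add_white U m)%:~R / (Lambda U R - 1)) ^+ (j - i) * pcoef U R md n i l)).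
  by move=> n; rewrite /inner_coef [RHS]big_nat.
apply: decays_sum => l /andP[ql _].
apply: (@decays_eq _ (fun n => ('C(l, q)%:R : R) * (
    ((add_white U m)%:~R / (1 - Lambda U R) * n.-1%:R) ^+ (l - q) *
  \sum_(l <= i < j.+1) 'C(j, i)%:R * ((balance U)%:R / m%:R) ^+ i *
        ((add_white U m)%:~R / (Lambda U R - 1)) ^+ (j - i) * pcoef U R md n i l))).
  by move=> n; rewrite !mulrA [_ / _ * _%:R]mulrAC.
apply: decaysZ; apply: decays_grow; rewrite subnK//.
apply: decays_sum => i _; apply: decaysZ; exact: decays_pcoef.
Qed.

(** The mean of sigma k / m is sigma W / T, and the centring is chosen such that its
constant term sigma c n / T, with c = a_m / (1 - Lambda), agrees with c up to
- c T_0 / T. *)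
Lemma inner_coef10 n : @inner_coef R U md n.+1 1 0 =
  - ((add_white U m)%:~R / (1 - Lambda U R)) * (total0 U)%:R / (Defs.total U n)%:R.
Proof.
have [[m0 s0 _ _ _] _] := hU.
have mn0 : m%:R != 0 :> R by rewrite pnatr_eq0 -lt0n.
have tn0 : (Defs.total U n)%:R != 0 :> R by rewrite pnatr_eq0 -lt0n (leq_trans _ (total_ge n)).
rewrite /inner_coef big_nat_recr//= big_nat1 big_nat1 big_nat_recr//= big_nat1.
rewrite pcoef00 pcoefS0 pcoef_diag ?(sample_le_total hU)//=.
have -> : match md with
   | without_replacement => 'C(m, 1)%:R / 'C(Defs.total U n, 1)%:R
   | with_replacement => (m ^_ 1)%:R / (Defs.total U n)%:R ^+ 1 end
   = m%:R / (Defs.total U n)%:R :> R by case: (md); rewrite ?bin1 ?ffactn1 ?expr1.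
have -> : (add_white U m)%:~R / (Lambda U R - 1) = - ((add_white U m)%:~R / (1 - Lambda U R)) :> R.
  by rewrite -(opprB 1) invrN mulrN.
pose c : R := (add_white U m)%:~R / (1 - Lambda U R).
have -> : (add_white U m)%:~R * n%:R / (1 - Lambda U R) = c * n%:R by rewrite mulrAC.
rewrite -/c !bin0 !bin1.
rewrite ?subn0 ?subnn ?expr0 ?expr1 ?mulr0 ?addr0 ?mulr1 ?mul1r.
have tE : (Defs.total U n)%:R = (total0 U)%:R + (balance U)%:R * n%:R :> R.
  by rewrite /Defs.total natrD natrM.
rewrite tE in tn0 *; field.
by rewrite mn0 tn0.
Qed.

(** For a_m = 0 the centring is trivial, and the moments of k of positive order have
no constant term in W. *)
Lemma decays_inner_coef0 j : (0 < j)%N -> add_white U m = 0 \/ j = 1%N ->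
  decays (fun n => @inner_coef R U md n j 0) 1.
Proof.
move=> j0 [a0|->]; last first.
  apply: (@decays_eq _ (fun n => (- ((add_white U m)%:~R / (1 - Lambda U R)) *
     (total0 U)%:R) * ((Defs.total U n.-1)%:R ^+ 1)^-1)).
    by move=> n; rewrite inner_coef10 expr1.
  by apply: decaysZ; apply: decays_inv_expn => n; exact: total_ge.
apply: decays_eq (decays0 1) => n; apply/esym.
rewrite /inner_coef a0 !mul0r big1_seq// => -[|l] _; last by rewrite expr0n mulr0 mul0r.
rewrite big1_seq ?mulr0// => -[|i] _; last by rewrite pcoefS0 mulr0.
by rewrite subn0 expr0n gtn_eqF// mulr0 mul0r.
Qed.

Lemma decays_fcoef s r : (r <= s)%N -> decays (fun n => fcoef U R md n s r) 0.
Proof.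
move=> rs; apply: (@decays_eq _ (fun n => \sum_(s - r <= j < s.+1)
  'C(s, j)%:R * Lambda U R ^+ j * @inner_coef R U md n j (j - (s - r)))).
  by move=> n; rewrite fcoef_inner.
apply: decays_sum => j _; apply: decaysZ.
exact: decaysW (leq0n _) (decays_inner_coef _ _).
Qed.

(** The terms j > s - r decay by decays_inner_coef; the term j = s - r is the constant
term treated in decays_inner_coef0. *)
Lemma decays_fcoef_lower s r : (r < s)%N -> add_white U m = 0 \/ s = r.+1 ->
  decays (fun n => fcoef U R md n s r) 1.
Proof.
move=> rs h; apply: (@decays_eq _ (fun n => \sum_(s - r <= j < s.+1 | (s - r <= j < s.+1)%N)
  'C(s, j)%:R * Lambda U R ^+ j * @inner_coef R U md n j (j - (s - r)))).
  by move=> n; rewrite fcoef_inner 1?ltnW// [RHS]big_nat.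
apply: decays_sum => j /andP[srj _]; apply: decaysZ.
have [E|/negP E] := boolP (j == s - r)%N.
  move/eqP : E => ->; rewrite subnn; apply: decays_inner_coef0; first by rewrite subn_gt0.
  by case: h => [h|->]; [left|right; rewrite subSnn].
apply: decaysW (decays_inner_coef _ _); lia.
Qed.

Lemma fcoef10 n : fcoef U R md n.+1 1 0 =
  - (Lambda U R * ((add_white U m)%:~R / (1 - Lambda U R)) * (total0 U)%:R / (Defs.total U n)%:R).
Proof.
rewrite fcoef_inner//= subn0 big_nat1 subnn inner_coef10 expr1 binn.
by ring.
Qed.

Lemma fcoef_diagE n s :
  fcoef U R md n.+1 s s = \sum_(j < s.+1) 'C(s, j)%:R * Cconst U R ^+ j *
  match md with
  | without_replacement => 'C(m, j)%:R / 'C(Defs.total U n, j)%:R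
  | with_replacement => (m ^_ j)%:R / (Defs.total U n)%:R ^+ j
  end.
Proof.
rewrite fcoef_diag; apply: eq_bigr => j _.
by rewrite pcoef_diag ?(sample_le_total hU)// -[_ * _ * _ ^+ j]mulrA -exprMn /Cconst mulrA.
Qed.

Lemma fcoef_diag_gt0 n s : 0 < Lambda U R -> 0 < fcoef U R md n.+1 s s.
Proof.
move=> L0; have C0 : 0 <= Cconst U R.
  by rewrite /Cconst divr_ge0// mulr_ge0// ltW.
rewrite fcoef_diagE big_ord_recl ltr_pwDl//.
  by case: (md); rewrite bin0 expr0 ?bin0 ?ffactn0 ?expr0 divr1 !mulr1.
apply: sumr_ge0 => j _; rewrite mulr_ge0 ?mulr_ge0 ?exprn_ge0//.
by case: (md); rewrite divr_ge0 ?exprn_ge0.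
Qed.

Lemma fcoef11 n : fcoef U R md n.+1 1 1 =
  1 + Lambda U R * (balance U)%:R / (Defs.total U n)%:R.
Proof.
have [[m0 s0 _ _ _] _] := hU.
have mn0 : m%:R != 0 :> R by rewrite pnatr_eq0 -lt0n.
have tn0 : (Defs.total U n)%:R != 0 :> R by rewrite pnatr_eq0 -lt0n (leq_trans _ (total_ge n)).
rewrite fcoef_diagE big_ord_recl big_ord_recl big_ord0 /= /bump /= addn0 /Cconst.
by case: (md); rewrite !bin0 ?bin1 ?ffactn0 ?ffactn1 !expr0 !expr1 ?binn; field; rewrite mn0 tn0.
Qed.

End CoefficientDecay.

(** * Products of shifted linear factors *)

Section LinearFactors.
Context {F : fieldType}.

Lemma prod_XaddC (I : Type) (r : seq I) (b : I -> F) :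
  \prod_(i <- r) ('X + (b i)%:P) = \prod_(x <- [seq - b i | i <- r]) ('X - x%:P).
Proof. by rewrite big_map; apply: eq_bigr => i _; rewrite polyCN opprK. Qed.

Lemma size_prod_XaddC (I : Type) (r : seq I) (b : I -> F) :
  size (\prod_(i <- r) ('X + (b i)%:P)) = (size r).+1.
Proof. by rewrite prod_XaddC size_prod_XsubC size_map. Qed.

Lemma monic_prod_XaddC (I : Type) (r : seq I) (b : I -> F) :
  \prod_(i <- r) ('X + (b i)%:P) \is monic.
Proof. by rewrite prod_XaddC monic_prod_XsubC. Qed.

Lemma coef_prod_XaddC (I : Type) (r : seq I) (b : I -> F) : (0 < size r)%N ->
  (\prod_(i <- r) ('X + (b i)%:P))`_(size r).-1 = \sum_(i <- r) b i.
Proof.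
move=> r0; rewrite prod_XaddC.
have h := @coefPn_prod_XsubC F [seq - b i | i <- r].
rewrite size_map in h; rewrite h -?lt0n// big_map sumrN opprK//.
Qed.

(** The two top coefficients only see the summands 0 and 1, since the summand l has
degree k - l. *)
Lemma monic_combination (k : nat) (c : nat -> F) (M : nat -> {poly F}) :
  c 0%N = 1 -> (forall l, (l <= k)%N -> M l \is monic /\ size (M l) = (k - l).+1) ->
  let p := \sum_(l < k.+1) c l *: M l in
  [/\ p \is monic, size p = k.+1 & (0 < k)%N -> p`_k.-1 = (M 0%N)`_k.-1 + c 1%N].
Proof.
move=> c0 hM p.
have [m0 s0] := hM 0%N (leq0n k); rewrite subn0 in s0.
pose q := \sum_(l < k) c l.+1 *: M l.+1.
have pE : p = M 0%N + q.
  by rewrite /p big_ord_recl c0 scale1r; congr (_ + _); apply: eq_bigr.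
have sq : (size q <= k)%N.
  apply: leq_trans (size_sum _ _ _) _; apply/bigmax_leqP => l _.
  apply: leq_trans (size_scale_leq _ _) _.
  have lk := ltn_ord l.
  by rewrite (hM l.+1 lk).2 -subSn// subSS leq_subr.
split.
- by rewrite monicE pE lead_coefDl -?monicE// s0 ltnS.
- by rewrite pE size_polyDl s0// ltnS.
- case: k @p @q hM s0 pE sq => // k p q hM s0 pE sq _ /=.
  rewrite pE coefD /q big_ord_recl coefD coefZ.
  have [m1 s1] := hM 1%N isT.
  have -> : (M 1%N)`_k = 1 by move: m1; rewrite monicE lead_coefE s1 subn1 => /eqP.
  rewrite mulr1 coef_sum big1 ?addr0// => l _.
  rewrite coefZ nth_default ?mulr0//.
  have lk := ltn_ord l.
  rewrite lift0 (hM l.+2 lk).2; lia.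
Qed.

End LinearFactors.

Section ProductAsymptotics.
Context {R : realType}.

Lemma cvg_prod (K : numFieldType) (I : Type) (r : seq I) (f : I -> nat -> K^o) (a : I -> K^o) :
  (forall i, f i @ \oo --> a i) ->
  (fun n => \prod_(i <- r) f i n : K^o) @ \oo --> (\prod_(i <- r) a i : K^o).
Proof.
move=> h; elim: r => [|i r IH].
  by rewrite big_nil; apply: cvg_near_cst; apply: nearW => n; rewrite big_nil.
have -> : (fun n => \prod_(j <- i :: r) f j n : K^o) =
    f i \* (fun n => \prod_(j <- r) f j n).
  by apply/funext => n /=; rewrite big_cons.
rewrite big_cons; exact: cvgM.
Qed.

(** Write phi as a product of quotients of linear factors and compare each linear
factor with Gauss's product.  The factorials cancel, and the powers of n combine
to n^kappa because of the assumption on the sums. *)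
Lemma product_asymptotic (k : nat) (lam : 'I_k -> R[i]) (alp : 'I_k -> R)
    (phi : nat -> R) (kappa : R) :
  (forall l, 0 < alp l) -> (forall N, 0 < phi N) ->
  \sum_l lam l = (\sum_l alp l + kappa)%:C ->
  (forall N : nat, \prod_l (lam l + N%:R) = (\prod_l (alp l + N%:R) * phi N)%:C) ->
  exists2 G : R, 0 < G &
    (fun n => (\prod_(j < n) phi j) / n%:R `^ kappa) @ \oo --> G /\
    G%:C = \prod_l (Gamma (alp l)%:C / Gamma (lam l)).
Proof.
move=> alp0 phi0 slam plam.
have alpN l (N : nat) : (alp l)%:C + N%:R != 0 :> R[i].
  by rewrite -(rmorph_nat (real_complex R)) -rmorphD /= eq_complex /= negb_and gt_eqF// ltr_wpDr.
have lamN l (N : nat) : lam l + N%:R != 0.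
  have : \prod_l (lam l + N%:R) != 0.
    rewrite plam eq_complex /= negb_and gt_eqF// mulr_gt0// prodr_gt0// => i _.
    by rewrite ltr_wpDr.
  by move/prodf_neq0; apply.
have Ga l : Gamma (alp l)%:C != 0 := Gamma_neq0 (alpN l).
have Gl l : Gamma (lam l) != 0 := Gamma_neq0 (lamN l).
pose u n := (\prod_(j < n.+1) phi j) / n.+1%:R `^ kappa.
have gN z n : (forall N : nat, z + N%:R != 0) -> gauss_product z n != 0 :> R[i].
  move=> hz; rewrite mulf_neq0//; first by apply/prodf_neq0 => i _.
  by rewrite invr_eq0 mulf_neq0 ?cpow_neq0// pnatr_eq0 -lt0n fact_gt0.
have uE n : (u n)%:C = \prod_l (gauss_product (lam l) n / gauss_product (alp l)%:C n).
  have n0 : 0 < n.+1%:R :> R by rewrite ltr0n.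
  have nf : n`!%:R != 0 :> R[i] by rewrite pnatr_eq0 -lt0n fact_gt0.
  have gE l : gauss_product (lam l) n / gauss_product (alp l)%:C n =
    (\prod_(j < n.+1) (lam l + j%:R)) / (\prod_(j < n.+1) ((alp l)%:C + j%:R)) *
     (cpow n.+1%:R (alp l)%:C / cpow n.+1%:R (lam l)).
    rewrite /gauss_product; field.
    rewrite !cpow_neq0// nf !andbT /=.
    by apply/prodf_neq0 => i _.
  under eq_bigr do rewrite gE.
  rewrite big_split /= !prodf_div exchange_big /=.
  under eq_bigr do rewrite plam.
  rewrite [X in _ / X * _]exchange_big /= -!cpow_sum// slam rmorphD /= cpowD// -rmorph_sum cpow_real.
  rewrite cpow_real -rmorph_prod big_split /=.
  have -> : \prod_(j < n.+1) \prod_i ((alp i)%:C + j%:R) =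
     (\prod_(j < n.+1) \prod_i (alp i + j%:R))%:C.
    rewrite rmorph_prod; apply: eq_bigr => j _; rewrite rmorph_prod.
    by apply: eq_bigr => i _; rewrite rmorphD /= rmorph_nat.
  set A := \prod_(j < n.+1) \prod_i (alp i + j%:R).
  have A0 : A != 0.
    by apply/prodf_neq0 => j _; apply/prodf_neq0 => i _; rewrite gt_eqF// ltr_wpDr.
  have c1 : n.+1%:R `^ (\sum_i alp i) != 0 :> R by rewrite gt_eqF// powR_gt0.
  have c2 : n.+1%:R `^ kappa != 0 :> R by rewrite gt_eqF// powR_gt0.
  rewrite -!rmorphM /= -!fmorphV -!rmorphM /= /u; congr (_%:C).
  by field; rewrite A0 c1 c2.
have cu : ((fun n => (u n)%:C) : nat -> R[i]^o) @ \oo -->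
    (\prod_l (Gamma (alp l)%:C / Gamma (lam l)) : R[i]^o).
  rewrite (funext uE).
  have -> : \prod_l (Gamma (alp l)%:C / Gamma (lam l)) =
     \prod_l ((Gamma (lam l))^-1 / (Gamma (alp l)%:C)^-1).
    by apply: eq_bigr => l _; rewrite invrK mulrC.
  apply: cvg_prod => l.
  apply: cvgM; first exact: gauss_product_cvg.
  apply: cvgV; first by rewrite invr_eq0.
  exact: gauss_product_cvg.
have [cR EL] := cvg_real_complex_inv cu.
set G := complex.Re _ in cR EL.
exists G; last first.
  split; last by rewrite EL.
  by rewrite -cvg_shiftS.
rewrite lt_neqAle; apply/andP; split.
  apply/eqP => G0; move/eqP : EL; rewrite -G0; apply/negP.
  by apply/prodf_neq0 => l _; rewrite mulf_neq0 ?invr_eq0.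
rewrite -(cvg_lim _ cR)//; apply: limr_ge; first by apply/cvg_ex; exists G.
by apply: nearW => n; rewrite divr_ge0 ?powR_ge0// prodr_ge0// => i _; exact: ltW.
Qed.

End ProductAsymptotics.

(** * The root polynomials *)

Lemma size_index_enum_ord k : size (index_enum 'I_k) = k.
Proof. by rewrite -[index_enum _]enumT -cardE card_ord. Qed.

Section NegatedRoots.
Context {R : realType}.
Implicit Types (p : {poly R}).

Lemma negated_roots_exist k p : p \is monic -> size p = k.+1 ->
  exists lam : k.-tuple R[i], negated_roots p lam.
Proof.
move=> pm sp.
have [r rE] := closed_field_poly_normal (map_poly (real_complex R) p).
have lc : lead_coef (map_poly (real_complex R) p) = 1.
  by rewrite lead_coef_map; move: pm; rewrite monicE => /eqP ->.
rewrite lc scale1r in rE.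
have sr : size [seq - x | x <- r] == k.
  have := congr1 (fun q : {poly R[i]} => size q) rE.
  by rewrite size_map_poly sp size_prod_XsubC size_map => -[->].
exists (Tuple sr); rewrite /negated_roots rE.
rewrite -(big_tuple _ _ (Tuple sr) xpredT (fun x => 'X + x%:P)) /= big_map.
by apply: eq_bigr => x _; rewrite polyCN.
Qed.

Lemma negated_roots_sum k p (lam : k.-tuple R[i]) : negated_roots p lam ->
  (0 < k)%N -> \sum_(l < k) tnth lam l = (p`_k.-1)%:C.
Proof.
move=> h k0; have := congr1 (fun q : {poly R[i]} => q`_k.-1) h.
rewrite coef_map /= => ->.
have := @coef_prod_XaddC _ _ (index_enum 'I_k) (tnth lam).
by rewrite size_index_enum_ord => ->.
Qed.

Lemma negated_roots_eval k p (lam : k.-tuple R[i]) (N : nat) : negated_roots p lam ->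
  \prod_(l < k) (tnth lam l + N%:R) = (p.[N%:R])%:C.
Proof.
move=> h; have := congr1 (fun q : {poly R[i]} => q.[N%:R]) h.
rewrite -{1}(rmorph_nat (real_complex R)) horner_map /= => ->.
rewrite horner_prod; apply: eq_bigr => l _.
by rewrite !hornerE addrC.
Qed.

End NegatedRoots.

Section RootPolynomials.
Context {R : realType} (U : urn).
Local Notation m := (sample_size U).
Local Notation sigma := ((balance U)%:R : R).
Local Notation T0 := ((total0 U)%:R : R).

Lemma natr_polyC k : k%:R = (k%:R : R)%:P.
Proof. by rewrite -(rmorph_nat (@polyC R)). Qed.

Lemma gbinom_linear (a c : R) k : a != 0 ->
  gbinom (a *: 'X + c%:P) k = (a ^+ k / k`!%:R) *: \prod_(i < k) ('X + ((c - i%:R) / a)%:P).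
Proof.
move=> a0; rewrite /gbinom (natr_polyC k`!) polyCV mulrC mul_polyC.
have -> : \prod_(i < k) (a *: 'X + c%:P - i%:R) = a ^+ k *: \prod_(i < k) ('X + ((c - i%:R) / a)%:P).
  rewrite -[k in a ^+ k]card_ord -prodr_const -scaler_prod /=.
  apply: eq_bigr => i _.
  rewrite scalerDr -[a *: _%:P]mul_polyC -polyCM mulrC divfK// polyCB -natr_polyC.
  by rewrite addrA.
by rewrite scalerA [_^-1 * _]mulrC.
Qed.

Lemma horner_gbinom (q : {poly R}) (x : R) k : (gbinom q k).[x] = gbinom q.[x] k.
Proof.
rewrite /gbinom (natr_polyC k`!) polyCV hornerM hornerC horner_prod; congr (_ / _).
by apply: eq_bigr => i _; rewrite natr_polyC hornerD hornerN hornerC.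
Qed.

Hypotheses (m0 : (0 < m)%N) (sigma0 : (0 < balance U)%N).

Let sigmaN0 : sigma != 0. Proof. by rewrite pnatr_eq0 -lt0n. Qed.
Let mN0 : m%:R != 0 :> R. Proof. by rewrite pnatr_eq0 -lt0n. Qed.

(** In the basis of products of k - l linear factors, the coefficients of index 0 and
1 are 1 and s Lambda. *)
Lemma rootpoly_without_monic s : (0 < s)%N -> let k := minn s m in
  [/\ rootpoly_without U R s \is monic, size (rootpoly_without U R s) = k.+1 &
  (rootpoly_without U R s)`_k.-1 = \sum_(i < k) (T0 - i%:R) / sigma + s%:R * Lambda U R].
Proof.
move=> s0 k.
have k0 : (0 < k)%N by rewrite /k leq_min s0.
pose c l := (k`!)%:R / sigma ^+ k * ('C(s, l)%:R / 'C(k, l)%:R * Cconst U R ^+ l * 'C(m, l)%:R)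
   * (sigma ^+ (k - l) / (k - l)`!%:R).
pose M l : {poly R} := \prod_(i < k - l) ('X + ((T0 - l%:R - i%:R) / sigma)%:P).
have E : rootpoly_without U R s = \sum_(l < k.+1) c l *: M l.
  rewrite /rootpoly_without -/k scaler_sumr; apply: eq_bigr => l _.
  by rewrite gbinom_linear// !scalerA.
have fk : (k`!)%:R != 0 :> R := factr_neq0 k.
have c0 : c 0%N = 1.
  rewrite /c subn0 !bin0 expr0; field.
  by rewrite fk expf_neq0.
have hM l : (l <= k)%N -> M l \is monic /\ size (M l) = (k - l).+1.
  move=> _; split; first exact: monic_prod_XaddC.
  by rewrite /M size_prod_XaddC size_index_enum_ord.
have [p1 p2 p3] := monic_combination c0 hM.
rewrite E; split=> //; rewrite p3//; congr (_ + _).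
  rewrite /M subn0.
  have := @coef_prod_XaddC R _ (index_enum 'I_k) (fun i => (T0 - 0%:R - i%:R) / sigma).
  rewrite size_index_enum_ord => -> //.
  by apply: eq_bigr => i _; rewrite subr0.
rewrite /c !bin1 expr1 /Cconst.
have kE : (k`!)%:R = k%:R * (k - 1)`!%:R :> R by rewrite -natrM subn1; case: (k) k0.
have sE : sigma ^+ k = sigma * sigma ^+ (k - 1) by rewrite -exprS subn1 prednK.
have kn0 : k%:R != 0 :> R by rewrite pnatr_eq0 -lt0n.
rewrite kE sE; field.
by rewrite kn0 sigmaN0 mN0 factr_neq0 expf_neq0.
Qed.

Lemma totalE N : (Defs.total U N)%:R = T0 + sigma * N%:R.
Proof. by rewrite /Defs.total natrD natrM. Qed.

Lemma rootpoly_with_monic s : (0 < s)%N ->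
  [/\ rootpoly_with U R s \is monic, size (rootpoly_with U R s) = s.+1 &
  (rootpoly_with U R s)`_s.-1 = \sum_(i < s) T0 / sigma + s%:R * Lambda U R].
Proof.
move=> s0.
pose c l := (sigma ^+ s)^-1 * ('C(s, l)%:R * Cconst U R ^+ l * 'C(m, l)%:R * (l`!)%:R)
   * sigma ^+ (s - l).
pose M l : {poly R} := \prod_(i < s - l) ('X + (T0 / sigma)%:P).
have E : rootpoly_with U R s = \sum_(l < s.+1) c l *: M l.
  rewrite /rootpoly_with scaler_sumr; apply: eq_bigr => l _.
  have -> : (sigma *: 'X + T0%:P) ^+ (s - l) = sigma ^+ (s - l) *: M l.
    rewrite /M prodr_const card_ord -exprZn scalerDr -[sigma *: _%:P]mul_polyC -polyCM.
    by rewrite [sigma * _]mulrC divfK.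
  by rewrite !scalerA.
have c0 : c 0%N = 1.
  rewrite /c subn0 !bin0 expr0 fact0; field.
  by rewrite expf_neq0.
have hM l : (l <= s)%N -> M l \is monic /\ size (M l) = (s - l).+1.
  move=> _; split; first exact: monic_prod_XaddC.
  by rewrite /M size_prod_XaddC size_index_enum_ord.
have [p1 p2 p3] := monic_combination c0 hM.
rewrite E; split=> //; rewrite p3//; congr (_ + _).
  rewrite /M subn0.
  have := @coef_prod_XaddC R _ (index_enum 'I_s) (fun i => T0 / sigma).
  by rewrite size_index_enum_ord => ->.
rewrite /c !bin1 expr1 (_ : 1`! = 1%N)// /Cconst.
have sE : sigma ^+ s = sigma * sigma ^+ (s - 1) by rewrite -exprS subn1 prednK.
rewrite sE; field.
by rewrite sigmaN0 mN0 expf_neq0.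
Qed.

(** The root polynomial is the numerator of f_(N+1,s,s) over the denominator
coming from binom(T_N, min(s, m)). *)
Lemma rootpoly_without_eval s N (hU : urn_assumptions U R without_replacement) :
  (rootpoly_without U R s).[N%:R] =
  \prod_(l < minn s m) ((T0 - l%:R) / sigma + N%:R) * fcoef U R without_replacement N.+1 s s.
Proof.
set k := minn s m.
set t := Defs.total U N.
have mt : (m <= t)%N := sample_le_total hU N.
have km : (k <= m)%N := geq_minr s m.
have tE : t%:R = T0 + sigma * N%:R by exact: totalE.
have -> : \prod_(l < k) ((T0 - l%:R) / sigma + N%:R) = (k`!)%:R / sigma ^+ k * 'C(t, k)%:R.
  have -> : (k`!)%:R / sigma ^+ k * 'C(t, k)%:R = falling t%:R k / sigma ^+ k.
    by rewrite falling_nat -bin_ffact natrM; ring.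
  rewrite /falling -[k in sigma ^+ k]card_ord -prodr_const -prodf_div.
  apply: eq_bigr => l _; rewrite tE; field; exact: sigmaN0.
rewrite /rootpoly_without -/k hornerZ -[RHS]mulrA; congr (_ * _).
rewrite (fcoef_diagE hU) horner_sum.
rewrite -(big_mkord xpredT (fun j => 'C(s, j)%:R * Cconst U R ^+ j * ('C(m, j)%:R / 'C(t, j)%:R))).
rewrite (@big_cat_nat _ _ _ k.+1)//=; last by rewrite ltnS geq_minl.
rewrite [X in _ = _ * (_ + X)]big_nat [X in _ = _ * (_ + X)]big1 ?addr0; last first.
  move=> j /andP[kj js]; have mj : (m < j)%N by move: kj; rewrite gtn_min => /orP[]//; lia.
  by rewrite [in 'C(m, j)]bin_small// mul0r mulr0.
rewrite big_mkord big_distrr /=; apply: eq_bigr => l _.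
have lk : (l <= k)%N by rewrite -ltnS.
rewrite hornerZ horner_gbinom.
have -> : (sigma *: 'X + (T0 - l%:R)%:P).[N%:R] = t%:R - l%:R.
  by rewrite hornerD hornerZ hornerX hornerC tE; ring.
have := falling_gbinom (t%:R : R) l (k - l).
rewrite subnKC// gbinom_nat falling_nat -!bin_ffact !natrM => h.
have fl : (l`!)%:R != 0 :> R := factr_neq0 l.
have Ct : 'C(t, l)%:R != 0 :> R by rewrite pnatr_eq0 -lt0n bin_gt0 (leq_trans lk)// (leq_trans km).
have Ck : 'C(k, l)%:R != 0 :> R by rewrite pnatr_eq0 -lt0n bin_gt0.
have {}h : gbinom (t%:R - l%:R) (k - l) = 'C(k, l)%:R * 'C(t, k)%:R / 'C(t, l)%:R :> R.
  apply: (mulfI Ct); apply: (mulfI fl); rewrite mulrA [(l`!)%:R * _]mulrC -h; field.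
  exact: Ct.
by rewrite h; field; rewrite Ct Ck.
Qed.

(** The root polynomial is the numerator of f_(N+1,s,s) over the denominator
(T_N / sigma)^s. *)
Lemma rootpoly_with_eval s N (hU : urn_assumptions U R with_replacement) :
  (rootpoly_with U R s).[N%:R] =
  \prod_(l < s) (T0 / sigma + N%:R) * fcoef U R with_replacement N.+1 s s.
Proof.
set t := Defs.total U N.
have tE : t%:R = T0 + sigma * N%:R by exact: totalE.
have t0 : t%:R != 0 :> R by rewrite pnatr_eq0 -lt0n (leq_trans _ (total_ge hU N)).
have -> : \prod_(l < s) (T0 / sigma + N%:R) = (sigma ^+ s)^-1 * t%:R ^+ s.
  rewrite prodr_const card_ord -exprVn -exprMn tE; congr (_ ^+ _).
  field; exact: sigmaN0.
rewrite /rootpoly_with hornerZ -[RHS]mulrA; congr (_ * _).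
rewrite (fcoef_diagE hU) horner_sum big_distrr /=; apply: eq_bigr => l _.
have ls : (l <= s)%N by rewrite -ltnS.
rewrite hornerZ horner_exp.
have -> : (sigma *: 'X + T0%:P).[N%:R] = t%:R by rewrite hornerD hornerZ hornerX hornerC tE addrC.
rewrite -bin_ffact natrM -[in t%:R ^+ s](subnK ls) exprD -/t; field.
by rewrite expf_neq0.
Qed.

End RootPolynomials.

(** * Perturbed linear recursions *)

Section Recursion.
Context {R : realType}.
Implicit Types (x phi e : nat -> R).

Lemma cvg_bounded (u : nat -> R) (l : R) : u @ \oo --> l ->
  exists2 B : R, 0 < B & forall n, `|u n| <= B.
Proof.
move=> ul; have cu : cvgn u by apply/cvg_ex; exists l.
have [M [Mr hM]] := cvg_seq_bounded cu; exists (`|M| + 1); first by rewrite ltr_wpDl.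
move=> n; apply: (hM (`|M| + 1)); last by [].
by rewrite (le_lt_trans (ler_norm M))// ltrDl.
Qed.

(** From 1 + u <= exp(u) and ln(1 + u) <= u; a discrete form of the derivative of
x^(-eps). *)
Lemma powR_telescope (eps x : R) : 0 < eps -> 0 < x ->
  eps * (x + 1) `^ (- 1 - eps) <= x `^ (- eps) - (x + 1) `^ (- eps).
Proof.
move=> e0 x0; have x1 : 0 < x + 1 by rewrite addr_gt0.
have -> : x `^ (- eps) = (x + 1) `^ (- eps) * expR (eps * (ln (x + 1) - ln x)).
  rewrite /powR !gt_eqF// -expRD; congr expR; ring.
have -> : (x + 1) `^ (- 1 - eps) = (x + 1) `^ (- eps) * (x + 1)^-1.
  rewrite (_ : -1 - eps = - eps + -1); last by ring.
  by rewrite powRD ?(gt_eqF x1) ?implybT// powR_inv1// ltW.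
rewrite mulrCA -[X in _ <= _ - X]mulr1 -mulrBr ler_wpM2l ?powR_ge0//.
have h := expR_ge1Dx (eps * (ln (x + 1) - ln x)).
suff : eps * (x + 1)^-1 <= eps * (ln (x + 1) - ln x) by lra.
have -> : ln (x + 1) - ln x = - ln (x / (x + 1)) by rewrite ln_div ?posrE// opprB.
apply: ler_wpM2l; first exact: ltW.
rewrite lerNr.
have := @le_ln1Dx R (- (x + 1)^-1).
rewrite (_ : 1 - (x + 1)^-1 = x / (x + 1)); last by field; rewrite gt_eqF.
by apply; rewrite ltrN2 invf_lt1// ltrDr.
Qed.

(** The partial sums are bounded by the telescoping sum of powR_telescope. *)
Lemma is_cvg_powR_series (eps : R) : 0 < eps ->
  cvgn (series (fun n => n.+1%:R `^ (- 1 - eps) : R)).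
Proof.
move=> e0; pose v n : R := n.+1%:R `^ (- eps).
apply: nondecreasing_is_cvgn.
  by apply: nondecreasing_series => n _ _; exact: powR_ge0.
exists (1 + eps^-1) => _ [n _ <-].
apply: (@le_trans _ _ (1 + eps^-1 * (1 - v n))); last first.
  by rewrite lerD2l; apply: ler_piMr; [rewrite invr_ge0 ltW|rewrite gerBl powR_ge0].
apply: (@le_trans _ _ (series (fun n => n.+1%:R `^ (- 1 - eps) : R) n.+1)).
  by rewrite [leRHS]/series /= big_nat_recr//= lerDl powR_ge0.
elim: n => [|n IH].
  rewrite /series /= big_nat1 powR1 /v powR1 subrr mulr0 addr0.
  exact: lexx.
rewrite /series /= big_nat_recr//=; apply: le_trans (lerD IH (lexx _)) _.
rewrite -addrA lerD2l -lerBrDl -mulrBr ler_pdivlMl//.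
have := @powR_telescope eps n.+1%:R e0 (ltr0Sn _ _).
rewrite natr1 /v; lra.
Qed.

(** Variation of constants: x n divided by prod phi is x 0 plus a partial sum of the
series, whose terms are O(l^(-1-eps)).  The bound on x is the induction hypothesis
for the next moment. *)
Lemma recursion_limit x phi e (kappa eps G D : R) :
  (forall n, 0 < phi n) -> (forall n, x n.+1 = phi n * x n + e n) ->
  0 <= kappa -> 0 < G -> (fun n => (\prod_(j < n) phi j) / n%:R `^ kappa) @ \oo --> G ->
  0 < eps -> (forall n, `|e n| <= D * n.+1%:R `^ (kappa - 1 - eps)) ->
  exists2 S : R, (fun n => \sum_(l < n) e l / \prod_(j < l.+1) phi j) @ \oo --> S &
    (fun n => x n / n%:R `^ kappa) @ \oo --> G * (x 0%N + S) /\
    exists2 B, 0 < B & forall n, `|x n| <= B * n.+1%:R `^ kappa.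
Proof.
move=> phi0 xS kappa0 G0 cG eps0 eD.
pose g n := \prod_(j < n) phi j.
have g0 n : 0 < g n by apply: prodr_gt0 => j _.
pose t l := e l / g l.+1.
have xE n : x n = g n * (x 0%N + \sum_(l < n) t l).
  elim: n => [|n IH]; first by rewrite /g !big_ord0 mul1r addr0.
  have gn : g n.+1 = g n * phi n by rewrite /g big_ord_recr.
  have pn := lt0r_neq0 (phi0 n); have gn0 := lt0r_neq0 (g0 n).
  rewrite xS IH [in RHS]big_ord_recr /= /t gn; field.
  by rewrite gn0 pn.
have pw n : 0 < n.+1%:R `^ kappa :> R by rewrite powR_gt0.
have cGS : (fun n => g n.+1 / n.+1%:R `^ kappa) @ \oo --> G.
  by move: cG; rewrite -cvg_shiftS.
have cGV : (fun n => (g n.+1 / n.+1%:R `^ kappa)^-1) @ \oo --> G^-1.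
  by apply: cvgV => //; exact: lt0r_neq0.
(* A bounds n^kappa / prod phi, that is, prod phi from below. *)
have [A A0 hA] := cvg_bounded cGV.
have tle n : `|t n| <= (D * A) * n.+1%:R `^ (- 1 - eps).
  have pn := pw n; have gn := g0 n.+1.
  have -> : t n = e n * n.+1%:R `^ (- kappa) * (g n.+1 / n.+1%:R `^ kappa)^-1.
    rewrite /t powRN; field.
    by rewrite !lt0r_neq0.
  rewrite !normrM (ger0_norm (powR_ge0 _ _)) mulrAC.
  have -> : n.+1%:R `^ (- 1 - eps) = n.+1%:R `^ (kappa - 1 - eps) * n.+1%:R `^ (- kappa) :> R.
    by rewrite -powRD ?pnatr_eq0 ?implybT//; congr (_ `^ _); ring.
  by rewrite [leRHS]mulrA ler_wpM2r ?powR_ge0// mulrAC ler_pM.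
have tc : cvgn (series t).
  apply: normed_cvg.
  apply: (@series_le_cvg _ _ (fun n => (D * A) * n.+1%:R `^ (- 1 - eps))) => //.
  - by move=> n /=.
  - by move=> n; exact: le_trans (normr_ge0 _) (tle n).
  have /cvg_ex[l hl] := is_cvg_powR_series eps0.
  apply/cvg_ex; exists (D * A * l).
  have -> : series (fun n => D * A * n.+1%:R `^ (- 1 - eps)) =
    (fun n => D * A * series (fun n => n.+1%:R `^ (- 1 - eps)) n).
    by apply/funext => n; rewrite /series /= mulr_sumr.
  exact: cvgMl_tmp.
have {tc}[S cS] : exists S : R, (fun n => \sum_(l < n) t l) @ \oo --> S.
  have -> : (fun n => \sum_(l < n) t l) = series t.
    by apply/funext => n; rewrite /series /= big_mkord.
  by move/cvg_ex : tc.
exists S => //.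
have cx : (fun n => x n / n%:R `^ kappa) @ \oo --> G * (x 0%N + S).
  have -> : (fun n => x n / n%:R `^ kappa) =
    (fun n => g n / n%:R `^ kappa) \* (fun n => x 0%N + \sum_(l < n) t l).
    by apply/funext => n /=; rewrite xE; ring.
  apply: cvgM cG _; apply: cvgD cS; exact: cvg_cst.
split=> //.
have cxS : (fun n => x n.+1 / n.+1%:R `^ kappa) @ \oo --> G * (x 0%N + S).
  by move: cx; rewrite -cvg_shiftS.
have [B B0 hB] := cvg_bounded cxS.
exists (B + `|x 0%N|); first by rewrite ltr_wpDr.
move=> [|n]; first by rewrite powR1 mulr1 lerDr ltW.
apply: (@le_trans _ _ (B * n.+1%:R `^ kappa)).
  have := hB n; rewrite normrM normfV (ger0_norm (powR_ge0 _ _)).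
  by rewrite ler_pdivrMr.
apply: ler_pM; rewrite ?powR_ge0 ?lerDl//; first exact: ltW.
by apply: ge0_ler_powR; rewrite ?nnegrE// ler_nat.
Qed.

End Recursion.

(** * Growth and limits of the moments *)

Section DiagonalProduct.
Context {R : realType} (U : urn).
Local Notation m := (sample_size U).
Local Notation sigma := ((balance U)%:R : R).
Local Notation T0 := ((total0 U)%:R : R).

(** The limit G is the same for every enumeration lam of the negated roots, because
limits are unique. *)
Lemma diagonal_product_without s (hU : urn_assumptions U R without_replacement) :
  (0 < s)%N -> 0 < Lambda U R ->
  exists2 G : R, 0 < G &
    (fun n => (\prod_(j < n) fcoef U R without_replacement j.+1 s s) / n%:R `^ (s%:R * Lambda U R))
      @ \oo --> G /\
  (exists lam : (minn s m).-tuple R[i], negated_roots (rootpoly_without U R s) lam) /\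
  (forall lam : (minn s m).-tuple R[i], negated_roots (rootpoly_without U R s) lam ->
    G%:C = \prod_(l < minn s m) (Gamma ((T0 - l%:R) / sigma)%:C / Gamma (tnth lam l))).
Proof.
move=> s0 L0; have [[m0 sigma0 _ _ _] mT] := hU.
have sg0 : 0 < sigma by rewrite ltr0n.
have [pm ps pc] := @rootpoly_without_monic R U m0 sigma0 s s0.
have k0 : (0 < minn s m)%N by rewrite leq_min s0.
have alp0 (l : 'I_(minn s m)) : 0 < (T0 - l%:R) / sigma.
  rewrite divr_gt0// subr_gt0 ltr_nat; apply: leq_trans (ltn_ord l) _.
  exact: leq_trans (geq_minr _ _) mT.
have key (lam : (minn s m).-tuple R[i]) : negated_roots (rootpoly_without U R s) lam ->
  exists2 G : R, 0 < G &
    (fun n => (\prod_(j < n) fcoef U R without_replacement j.+1 s s) / n%:R `^ (s%:R * Lambda U R))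
      @ \oo --> G /\
    G%:C = \prod_(l < minn s m) (Gamma ((T0 - l%:R) / sigma)%:C / Gamma (tnth lam l)).
  move=> hl; apply: (@product_asymptotic R _ (tnth lam) _
    (fun j => fcoef U R without_replacement j.+1 s s) _ alp0).
  - by move=> N; exact: (fcoef_diag_gt0 hU).
  - by rewrite (negated_roots_sum hl)// pc.
  - by move=> N; rewrite (negated_roots_eval _ hl) rootpoly_without_eval.
have [lam0 h0] := negated_roots_exist pm ps.
have [G G0 [cG EG]] := key lam0 h0.
exists G => //; split=> //; split; first by exists lam0.
move=> lam /key[G' _ [cG' EG']].
by have -> : G = G' by exact: (cvg_unique (@norm_hausdorff _ _) cG cG').
Qed.

Lemma diagonal_product_with s (hU : urn_assumptions U R with_replacement) :
  (0 < s)%N -> 0 < Lambda U R ->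
  exists2 G : R, 0 < G &
    (fun n => (\prod_(j < n) fcoef U R with_replacement j.+1 s s) / n%:R `^ (s%:R * Lambda U R))
      @ \oo --> G /\
  (exists lam : s.-tuple R[i], negated_roots (rootpoly_with U R s) lam) /\
  (forall lam : s.-tuple R[i], negated_roots (rootpoly_with U R s) lam ->
    G%:C = \prod_(l < s) (Gamma (T0 / sigma)%:C / Gamma (tnth lam l))).
Proof.
move=> s0 L0; have [[m0 sigma0 _ _ _] mT] := hU.
have sg0 : 0 < sigma by rewrite ltr0n.
have [pm ps pc] := @rootpoly_with_monic R U m0 sigma0 s s0.
have alp0 (l : 'I_s) : 0 < T0 / sigma.
  by rewrite divr_gt0// ltr0n (leq_trans m0).
have key (lam : s.-tuple R[i]) : negated_roots (rootpoly_with U R s) lam ->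
  exists2 G : R, 0 < G &
    (fun n => (\prod_(j < n) fcoef U R with_replacement j.+1 s s) / n%:R `^ (s%:R * Lambda U R))
      @ \oo --> G /\
    G%:C = \prod_(l < s) (Gamma (T0 / sigma)%:C / Gamma (tnth lam l)).
  move=> hl; apply: (@product_asymptotic R _ (tnth lam) _
    (fun j => fcoef U R with_replacement j.+1 s s) _ alp0).
  - by move=> N; exact: (fcoef_diag_gt0 hU).
  - by rewrite (negated_roots_sum hl)// pc.
  - by move=> N; rewrite (negated_roots_eval _ hl) rootpoly_with_eval.
have [lam0 h0] := negated_roots_exist pm ps.
have [G G0 [cG EG]] := key lam0 h0.
exists G => //; split=> //; split; first by exists lam0.
move=> lam /key[G' _ [cG' EG']].
by have -> : G = G' by exact: (cvg_unique (@norm_hausdorff _ _) cG cG').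
Qed.

Lemma diagonal_product md s (hU : urn_assumptions U R md) :
  0 < Lambda U R ->
  exists2 G : R, 0 < G &
    (fun n => (\prod_(j < n) fcoef U R md j.+1 s s) / n%:R `^ (s%:R * Lambda U R)) @ \oo --> G.
Proof.
move=> L0; case: s => [|s].
  exists 1 => //; apply: cvg_near_cst; apply: nearW => n.
  rewrite mul0r powRr0 divr1 big1// => j _.
  by rewrite fcoef_diag big_ord1 pcoef00 bin0 !expr0 !mulr1.
case: md hU => hU.
  by have [G G0 [h _]] := diagonal_product_without hU (ltn0Sn s) L0; exists G.
by have [G G0 [h _]] := diagonal_product_with hU (ltn0Sn s) L0; exists G.
Qed.

End DiagonalProduct.

Section MomentGrowth.
Context {R : realType} (d : measure_display) (T : measurableType d).
Variables (P : probability T R) (md : model) (U : urn) (K : nat -> {RV P >-> nat}).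
Hypothesis hK : urn_process U md K.
Hypothesis hU : urn_assumptions U R md.
Hypothesis hL : large_index U R \/ triangular U.
Local Notation m := (sample_size U).
Local Notation Lam := (Lambda U R).

(** The exponent gained in the series: the lower moments of index s - 1 and of index
at most s - 2 (which have no decaying coefficient if a_m <> 0) gain Lambda and
2 Lambda - 1 respectively. *)
Lemma Lambda_gap : exists eps : R,
  [/\ 0 < eps, eps <= Lam & add_white U m = 0 \/ eps <= 2 * Lam - 1].
Proof.
have [[m0 sigma0 _ _ _] _] := hU.
case: hL => [[am /andP[L1 L2]]|[a0 a1 _]].
  have e0 : 0 < 2 * Lam - 1 by lra.
  exists (2 * Lam - 1); split=> //; [lra|by right].
have L0 : 0 < Lam.
  by rewrite /Lambda a0 subr0 mulr_gt0// ?divr_gt0 ?ltr0n// ltr0z.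
by exists Lam; split=> //; left.
Qed.

Lemma Lambda_gt0 : 0 < Lam.
Proof. by have [eps [h1 h2 _]] := Lambda_gap; exact: lt_le_trans h2. Qed.

Lemma Lambda_neq1 : add_white U m = 0 \/ Lam != 1.
Proof.
case: hL => [[am /andP[L1 L2]]|[a0 a1 _]]; last by left.
by right; rewrite lt_eqF.
Qed.

Lemma dominated_sum (w : nat -> R) (I : Type) (r : seq I) (F : I -> nat -> R) :
  (forall i, exists D, forall n, `|F i n| <= D * w n) ->
  exists D, forall n, `|\sum_(i <- r) F i n| <= D * w n.
Proof.
move=> h; elim: r => [|i r [D hD]].
  by exists 0 => n; rewrite big_nil normr0 mul0r.
have [D' hD'] := h i; exists (D' + D) => n.
by rewrite big_cons mulrDl (le_trans (ler_normD _ _))// lerD.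
Qed.

(** The inhomogeneous part of the recursion for the s-th moment. *)
Definition lower_terms s n := \sum_(i < s) fcoef U R md n.+1 s i * moment U K i n.

(** A coefficient O(1/n) in front of a moment of index at most s - 1 gains
1 + Lambda, and a bounded coefficient in front of a moment of index at most s - 2
gains 2 Lambda; both are at least 1 + eps. *)
Lemma lower_terms_bound s (eps : R) :
  0 < eps -> eps <= Lam -> add_white U m = 0 \/ eps <= 2 * Lam - 1 ->
  (forall i, (i < s)%N -> exists2 B, 0 < B &
     forall n, `|moment U K i n| <= B * n.+1%:R `^ (i%:R * Lam)) ->
  exists D, forall n, `|lower_terms s n| <= D * n.+1%:R `^ (s%:R * Lam - 1 - eps).
Proof.
move=> e0 eL am hB; apply: dominated_sum => i.
have [B B0 {}hB] := hB i (ltn_ord i).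
have L0 := Lambda_gt0.
have iS : (i%:R : R) + 1 <= s%:R by rewrite natr1 ler_nat.
have pw n (p q : R) : p <= q -> n.+1%:R `^ p <= n.+1%:R `^ q :> R.
  by apply: ler_powR; rewrite ler1n.
(* Either the coefficient is O(1/n), or i <= s - 2. *)
have [h|h] : (add_white U m = 0 \/ s = i.+1) \/ (eps <= 2 * Lam - 1 /\ (i.+2 <= s)%N).
  have [/eqP si|si] := boolP (s == i.+1); first by left; right.
  case: am => [->|h]; first by left; left.
  by right; split=> //; rewrite ltn_neqAle eq_sym si ltn_ord.
- have [A hA] := decays_fcoef_lower hU (ltn_ord i) h.
  have A0 : 0 <= A by apply: le_trans (hA 0%N); rewrite mulr_ge0.
  exists (A * B) => n; rewrite normrM.
  apply: (@le_trans _ _ (A * n.+1%:R^-1 * (B * n.+1%:R `^ (i%:R * Lam)))).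
    apply: ler_pM => //; by rewrite ler_pdivlMr ?ltr0n.
  rewrite mulrACA ler_wpM2l ?mulr_ge0//; first exact: ltW.
  rewrite -[n.+1%:R^-1]powR_inv1// -powRD ?pnatr_eq0 ?implybT//.
  by apply: pw; nra.
- have [A hA] := decays_fcoef hU (ltnW (ltn_ord i)).
  have A0 : 0 <= A by apply: le_trans (hA 0%N); rewrite mulr_ge0.
  exists (A * B) => n; rewrite normrM.
  apply: (@le_trans _ _ (A * (B * n.+1%:R `^ (i%:R * Lam)))).
    by apply: ler_pM => //; have := hA n; rewrite expr0 mulr1.
  rewrite mulrA ler_wpM2l ?mulr_ge0//; first exact: ltW.
  case: h => h1 h2; have i2 : (i%:R : R) + 2 <= s%:R by rewrite -natrD addn2 ler_nat.
  by apply: pw; nra.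
Qed.

Lemma moment_step s n :
  moment U K s n.+1 = fcoef U R md n.+1 s s * moment U K s n + lower_terms s n.
Proof. by rewrite (momentS hK hU Lambda_neq1) big_ord_recr /= addrC. Qed.

Lemma moment_limit_from s (G : R) :
  (forall i, (i < s)%N -> exists2 B, 0 < B &
     forall n, `|moment U K i n| <= B * n.+1%:R `^ (i%:R * Lam)) ->
  0 < G ->
  (fun n => (\prod_(j < n) fcoef U R md j.+1 s s) / n%:R `^ (s%:R * Lam)) @ \oo --> G ->
  exists2 S : R, (fun n => \sum_(l < n) lower_terms s l / \prod_(j < l.+1) fcoef U R md j.+1 s s) @ \oo --> S &
    (fun n => moment U K s n / n%:R `^ (s%:R * Lam)) @ \oo --> G * (moment U K s 0 + S) /\
    exists2 B, 0 < B & forall n, `|moment U K s n| <= B * n.+1%:R `^ (s%:R * Lam).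
Proof.
move=> hB G0 cG.
have [eps [e0 eL am]] := Lambda_gap.
have [D hD] := lower_terms_bound e0 eL am hB.
have L0 := Lambda_gt0.
apply: (recursion_limit _ (moment_step s) _ G0 cG e0 hD).
- by move=> n; exact: (fcoef_diag_gt0 hU).
- by rewrite mulr_ge0// ltW.
Qed.

Lemma moment_growth s : exists2 B, 0 < B &
  forall n, `|moment U K s n| <= B * n.+1%:R `^ (s%:R * Lam).
Proof.
elim/ltn_ind: s => s IH.
have [G G0 cG] := diagonal_product s hU Lambda_gt0.
by have [S _ [_ h]] := moment_limit_from IH G0 cG.
Qed.

Lemma moment_limit s (G : R) : 0 < G ->
  (fun n => (\prod_(j < n) fcoef U R md j.+1 s s) / n%:R `^ (s%:R * Lam)) @ \oo --> G ->
  exists2 S : R, (fun N => \sum_(1 <= l < N.+1) series_term U md K s l) @ \oo --> S &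
    (fun n => moment U K s n / n%:R `^ (s%:R * Lam)) @ \oo --> G * ((white0 U)%:R ^+ s + S).
Proof.
move=> G0 cG.
have [S cS [cE _]] := moment_limit_from (fun i _ => moment_growth i) G0 cG.
exists S; last by rewrite -(moment0 hK).
move: cS; rewrite (_ : (fun N => \sum_(1 <= l < N.+1) _) =
  (fun n => \sum_(l < n) lower_terms s l / \prod_(j < l.+1) fcoef U R md j.+1 s s))//.
apply/funext => N; rewrite big_add1 /= big_mkord; apply: eq_bigr => l _.
by rewrite /series_term big_add1 /= big_mkord.
Qed.

Lemma cvg_powRN (a : R) : 0 < a -> (fun n => (n%:R `^ a)^-1 : R) @ \oo --> (0 : R).
Proof.
move=> a0; apply/cvgrPdist_le => e e0; near=> n.
rewrite sub0r normrN ger0_norm ?invr_ge0 ?powR_ge0//.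
have n0 : 0 < n%:R :> R by rewrite ltr0n; near: n; exact: nbhs_infty_gt.
rewrite -[leRHS]invrK lef_pV2 ?posrE ?powR_gt0 ?invr_gt0//.
have -> : e^-1 = (e^-1 `^ a^-1) `^ a.
  by rewrite -powRrM mulVf ?gt_eqF// powRr1// invr_ge0 ltW.
apply: ge0_ler_powR; rewrite ?nnegrE ?powR_ge0//; first exact: ltW.
by near: n; exact: nbhs_infty_ger.
Unshelve. all: end_near. Qed.

(** The recursion of the first moment has the constant solution c T_0 / sigma, with
c = a_m / (1 - Lambda), and n^Lambda tends to infinity. *)
Lemma first_moment_limit : exists G : R,
  G%:C = Gamma ((total0 U)%:R / (balance U)%:R : R)%:C /
         Gamma ((total0 U)%:R / (balance U)%:R + Lam)%:C /\
  (fun n => moment U K 1 n / n%:R `^ (1%:R * Lam)) @ \oo -->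
    ((white0 U)%:R - (add_white U m)%:~R / (1 - Lam) * (total0 U)%:R / (balance U)%:R) * G.
Proof.
have L0 := Lambda_gt0.
have [[m0 sigma0 _ _ _] mT] := hU.
have sg0 : 0 < (balance U)%:R :> R by rewrite ltr0n.
have t0 : 0 < (total0 U)%:R :> R by rewrite ltr0n (leq_trans m0).
pose c : R := (add_white U m)%:~R / (1 - Lam) * (total0 U)%:R / (balance U)%:R.
have alp0 (l : 'I_1) : 0 < (total0 U)%:R / (balance U)%:R :> R by rewrite divr_gt0.
have tn0 n : (Defs.total U n)%:R != 0 :> R by rewrite pnatr_eq0 -lt0n (leq_trans _ (total_ge hU n)).
have [||n|G G0 [cG EG]] := product_asymptotic (lam := fun _ => ((total0 U)%:R / (balance U)%:R + Lam)%:C)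
  (phi := fun j => fcoef U R md j.+1 1 1) (kappa := Lam) alp0.
- by move=> N; exact: (fcoef_diag_gt0 hU).
- by rewrite !big_ord1.
- rewrite !big_ord1 -(rmorph_nat (real_complex R)) -rmorphD /= (fcoef11 hU); congr (_%:C).
  move: (tn0 n); rewrite totalE => tn.
  by field; rewrite tn gt_eqF.
exists G; split; first by rewrite EG big_ord1.
have mE n : moment U K 1 n = ((white0 U)%:R - c) * (\prod_(j < n) fcoef U R md j.+1 1 1) + c.
  elim: n => [|n IH]; first by rewrite (moment0 hK) expr1 big_ord0 mulr1 subrK.
  have m0E : moment U K 0 n = 1.
    elim: n {IH} => [|n IH]; first by rewrite (moment0 hK).
    rewrite (momentS hK hU Lambda_neq1) big_ord1 IH mulr1 fcoef_diag big_ord1.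
    by rewrite pcoef00 bin0 !expr0 !mulr1.
  rewrite moment_step /lower_terms big_ord1 m0E mulr1 IH big_ord_recr /=.
  rewrite (fcoef10 hU) (fcoef11 hU) /c.
  move: (tn0 n); set q := add_white U m; set t := (Defs.total U n)%:R => tn.
  move: ((q)%:~R / (1 - Lam)) (\prod_(j < n) _) => y p.
  by field; rewrite tn gt_eqF.
have -> : (fun n => moment U K 1 n / n%:R `^ (1%:R * Lam)) =
  (fun n => ((white0 U)%:R - c) * ((\prod_(j < n) fcoef U R md j.+1 1 1) / n%:R `^ Lam)
    + c * (n%:R `^ Lam)^-1).
  by apply/funext => n; rewrite mE mul1r; ring.
rewrite -[X in _ --> X]addr0 -[X in _ --> _ + X](mulr0 c); apply: cvgD.
  exact: cvgMl_tmp.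
by apply: cvgMl_tmp; exact: cvg_powRN.
Qed.

End MomentGrowth.

Theorem theorem1 (R : realType) (d : measure_display) (T : measurableType d)
    (P : probability T R) (md : model) (U : urn) (K : nat -> {RV P >-> nat})
    (hU : urn_assumptions U R md) (hK : urn_process U md K)
    (hL : large_index U R \/ triangular U)
    (s : nat) (hs : (1 <= s)%N) :
  let Lam : R := Lambda U R in
  let m := sample_size U in
  let sigma : R[i] := (balance U)%:R in
  let T0 : R[i] := (total0 U)%:R in
  let s' := minn s m in
  exists E : R,
  [/\ (fun n : nat => moment U K s n / n%:R `^ (s%:R * Lam)) @ \oo --> E,
      s = 1%N ->
      E%:C = ((white0 U)%:R -
              (add_white U m)%:~R * T0 / sigma / (1 - Lam)%:C)
             * Gamma (T0 / sigma) / Gamma (T0 / sigma + Lam%:C)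
    & exists S : R,
      (fun N : nat => \sum_(1 <= l < N.+1) series_term U md K s l) @ \oo --> S
      /\
      match md with
      | without_replacement =>
          (exists lam : s'.-tuple R[i],
             negated_roots (rootpoly_without U R s) lam) /\
          (forall lam : s'.-tuple R[i],
             negated_roots (rootpoly_without U R s) lam ->
             E%:C = (\prod_(l < s') (Gamma ((T0 + 1 - (l.+1)%:R) / sigma)
                                     / Gamma (tnth lam l)))
                    * ((white0 U)%:R ^+ s + S%:C))
      | with_replacement =>
          (exists mu : s.-tuple R[i],
             negated_roots (rootpoly_with U R s) mu) /\
          (forall mu : s.-tuple R[i],
             negated_roots (rootpoly_with U R s) mu ->
             E%:C = Gamma (T0 / sigma) ^+ s
                    / (\prod_(l < s) Gamma (tnth mu l))
                    * ((white0 U)%:R ^+ s + S%:C))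
      end].
Proof.
move=> Lam m sigma T0 s'.
have L0 := Lambda_gt0 hU hL.
have natC k : k%:R = (k%:R : R)%:C :> R[i] by rewrite rmorph_nat.
have [G1 [EG1 c1]] := first_moment_limit hK hU hL.
have first (E : R) : s = 1%N ->
    (fun n => moment U K s n / n%:R `^ (s%:R * Lam)) @ \oo --> E ->
    E%:C = ((white0 U)%:R - (add_white U m)%:~R * T0 / sigma / (1 - Lam)%:C)
             * Gamma (T0 / sigma) / Gamma (T0 / sigma + Lam%:C).
  move=> s1; rewrite s1 => cE.
  have -> : E = ((white0 U)%:R - (add_white U m)%:~R / (1 - Lam) * (total0 U)%:R / (balance U)%:R) * G1.
    exact: (cvg_unique (@norm_hausdorff _ _) cE c1).
  have qE : T0 / sigma = ((total0 U)%:R / (balance U)%:R : R)%:C.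
    by rewrite /T0 /sigma !natC -fmorphV -rmorphM.
  rewrite rmorphM /= EG1 qE -rmorphD /= mulrA; congr (_ * _ * _).
  rewrite /T0 /sigma !natC -(rmorph_int (real_complex R)).
  rewrite -!fmorphV -!rmorphM -rmorphB /=; congr (_%:C).
  by ring.
case: md hU hK {c1 EG1 G1} first => hU' hK' first.
  have [G G0 [cG [ex all]]] := diagonal_product_without hU' hs L0.
  have [S cS cE] := moment_limit hK' hU' hL G0 cG.
  exists (G * ((white0 U)%:R ^+ s + S)); split=> //.
    by move=> s1; exact: first.
  exists S; split=> //; split=> // lam /all EG.
  rewrite rmorphM rmorphD rmorphXn /= rmorph_nat EG; congr (_ * _).
  apply: eq_bigr => l _; congr (Gamma _ / _).
  have -> : T0 + 1 - l.+1%:R = T0 - l%:R by rewrite -natr1 opprD addrACA subrr addr0.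
  by rewrite /T0 /sigma !natC -rmorphB -fmorphV -rmorphM.
have [G G0 [cG [ex all]]] := diagonal_product_with hU' hs L0.
have [S cS cE] := moment_limit hK' hU' hL G0 cG.
exists (G * ((white0 U)%:R ^+ s + S)); split=> //.
  by move=> s1; exact: first.
exists S; split=> //; split=> // lam /all EG.
rewrite rmorphM rmorphD rmorphXn /= rmorph_nat EG; congr (_ * _).
rewrite prodf_div prodr_const card_ord; congr (Gamma _ ^+ _ / _).
by rewrite /T0 /sigma !natC -fmorphV -rmorphM.
Qed.
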